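(* Let $q=3^m$, where $m$ is a positive integer. Let $a,b,c,d\in\mathbb{F}_{q^2}$ be not all zero, and let $g(x)=\frac{d^qx^3+c^qx^2+b^qx+a^q}{ax^3+bx^2+cx+d}\in\mathbb{F}_{q^2}(x)$. Assume that $\deg(g)=3$ and that $g$ is separable. Let $\alpha=\frac{cd^q-ab^q}{bd^q-ac^q}$ and $\beta=\frac{c^q}{b}$. Fix an element $\gamma\in\mathbb{F}_{q^2}$ of multiplicative order $q+1$. Then $g(x)$ permutes $\mu_{q+1}$ if and only if $bd^q\neq ac^q$, $\left(\frac{cd^q-ab^q}{bd^q-ac^q}\right)^3=\frac{c^qd-a^qb}{bd^q-ac^q}$, $\alpha,\beta\in\mu_{q+1}$, and one of the following conditions is satisfied: (1) $\alpha\notin\mathbb{F}_q$, $\beta\notin\mathbb{F}_q$, and $\frac{B_3-\beta A_3}{\beta A_1-B_1}$ is a nonsquare of $\mathbb{F}_q^{*}$, where $A_1=d^q\alpha^3+c^q\alpha^2+b^q\alpha+a^q$, $A_3=c^q(2\alpha^2+1)+b^q(2\alpha+\alpha^3)$, $B_1=a\alpha^3+b\alpha^2+c\alpha+d$, and $B_3=b(2\alpha^2+1)+c(2\alpha+\alpha^3)$; (2) $\alpha\notin\mathbb{F}_q$, $\beta\in\mathbb{F}_q$, and $\frac{\beta\alpha^qB_3-\alpha A_3}{\alpha A_1-\beta\alpha^qB_1}$ is a nonsquare of $\mathbb{F}_q^{*}$, where $A_1,A_3,B_1,B_3$ are given by the same formulas as in (1); (3) $\alpha\in\mathbb{F}_q$,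 $\beta\notin\mathbb{F}_q$, and $\frac{B_3-\beta A_3}{\beta A_1-B_1}$ is a nonsquare of $\mathbb{F}_q^{*}$, where $A_1=d^q\alpha^3+c^q\alpha^2+b^q\alpha+a^q$, $A_3=c^q(2\alpha^2+\alpha^2\beta^{q-1})+b^q(2\alpha+\alpha\beta^2)$, $B_1=a\alpha^3+b\alpha^2+c\alpha+d$, and $B_3=b(2\alpha^2+\alpha^2\beta^{q-1})+c(2\alpha+\alpha\beta^2)$; (4) $\alpha\in\mathbb{F}_q$, $\beta\in\mathbb{F}_q$, and $\frac{\beta\gamma^qB_3-\gamma A_3}{\gamma A_1-\beta\gamma^qB_1}$ is a nonsquare of $\mathbb{F}_q^{*}$, where $A_1=d^q\alpha^3+c^q\alpha^2+b^q\alpha+a^q$, $A_3=c^q(2\alpha^2+\alpha^2\gamma^{q-1})+b^q(2\alpha+\alpha\gamma^2)$, $B_1=a\alpha^3+b\alpha^2+c\alpha+d$, and $B_3=b(2\alpha^2+\alpha^2\gamma^{q-1})+c(2\alpha+\alpha\gamma^2)$.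
   Context: $\mu_{q+1}$ denotes the set of $(q+1)$-th roots of unity in $\mathbb{F}_{q^2}$. A rational function is identified with its reduced form $N_0/D_0$ with $N_0,D_0$ coprime; its degree is $\max(\deg N_0,\deg D_0)$. A rational function permutes a set $S$ if it restricts to a bijection $S\to S$. A nonconstant $g(x)\in K(x)$ is separable if the field extension $K(x)/K(g(x))$ is separable; equivalently, $g(x)\notin K(x^p)$ with $p=\operatorname{char}K$. ''Is a nonsquare of $\mathbb{F}_q^{*}$'' means: lies in $\mathbb{F}_q^{*}$ and is not a square in $\mathbb{F}_q^{*}$. A condition involving a quotient (including $\alpha,\beta\in\mu_{q+1}$) includes the requirement that its denominator is nonzero. *)

(* Defs.v *)
From HB Require Import structures.
From mathcomp Require Import all_boot all_order all_algebra all_field.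

Set Implicit Arguments.
Unset Strict Implicit.
Unset Printing Implicit Defensive.

Import GRing.Theory.
Local Open Scope ring_scope.
Local Open Scope quotient_scope.

Notation "x %:F" := (tofrac x) : ring_scope.

Section RationalFunctions.

Variable K : fieldType.

(* The reduced form N0 / D0 of g : K(x): any representative of g with the gcd
   cancelled. It is unique up to a common nonzero constant factor, which affects
   neither the degree nor the values below. *)
Definition rf_num (g : {fraction {poly K}}) : {poly K} :=
  let r := repr g in \n_r %/ gcdp \n_r \d_r.

Definition rf_den (g : {fraction {poly K}}) : {poly K} :=
  let r := repr g in \d_r %/ gcdp \n_r \d_r.

(* [size p] is the degree plus one, and [rf_den g] is never zero. *)
Definition rf_deg (g : {fraction {poly K}}) : nat :=
  (maxn (size (rf_num g)) (size (rf_den g))).-1.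

(* Only meaningful at points that are not poles, i.e. roots of [rf_den g]. *)
Definition rf_eval (g : {fraction {poly K}}) (x : K) : K :=
  (rf_num g).[x] / (rf_den g).[x].

Definition rf_subst (g : {fraction {poly K}}) (p : {poly K}) :
    {fraction {poly K}} :=
  (map_poly (fun c : K => (c%:P)%:F) p).[g].

(* u belongs to the subfield K(g) of K(x). *)
Definition in_adjoin (g u : {fraction {poly K}}) : Prop :=
  exists N D : {poly K},
    rf_subst g D != 0 /\ u = rf_subst g N / rf_subst g D.

(* The extension K(x) / K(g) is (algebraic and) separable: every element of K(x)
   is a root of a separable polynomial over K(g). For constant g this fails,
   since x is then transcendental over K(g) = K. *)
Definition rf_separable (g : {fraction {poly K}}) : Prop :=
  forall u : {fraction {poly K}},
    exists P : {poly {fraction {poly K}}},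
      [/\ forall i : nat, in_adjoin g P`_i, separable_poly P & root P u].

End RationalFunctions.

Section FiniteField.

Variable F : finFieldType.

(* g has no pole in S and restricts to a bijection from S onto S. *)
Definition permutes (g : {fraction {poly F}}) (S : {set F}) : Prop :=
  [/\ {in S, forall x, (rf_den g).[x] != 0},
      {in S &, injective (rf_eval g)}
    & [set rf_eval g x | x in S] = S].

Definition mu (n : nat) : {set F} := [set x | n.-unity_root x].

(* The subfield of order q, when #|F| is a power of q. *)
Definition Fq (q : nat) : {set F} := [set x | x ^+ q == x].

Definition nonsquare_Fq (q : nat) (y : F) : Prop :=
  [/\ y \in Fq q, y != 0 & ~ exists2 z : F, z \in Fq q & y = z ^+ 2].

(* In this library n / 0 = 0, so the nonvanishing of the denominator is made
   explicit. *)
Definition quotient_nonsquare_Fq (q : nat) (n d : F) : Prop :=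
  d != 0 /\ nonsquare_Fq q (n / d).

End FiniteField.

(* Main.v *)
Require Import Defs.
From HB Require Import structures.
From mathcomp Require Import all_boot all_order all_algebra all_field.
From mathcomp Require Import ring zify.

Set Implicit Arguments.
Unset Strict Implicit.
Unset Printing Implicit Defensive.

Import GRing.Theory.
Local Open Scope ring_scope.

(** Let s be the map x |-> x^q, an involution of the field with q^2 elements,
    and let N and D be the numerator and the denominator of g.  The group of
    (q+1)-th roots of unity consists of the x with x * s x = 1, called unitary
    below.  There N x = x^3 * s (D x), so g maps the group to itself, and to
    permute it means to be injective on it ([permutes_injective]).

    For unitary t look at the cubic N - t D, whose roots are the preimages
    of t, with coefficients p3 = s d - t a, p2 = s c - t b, p1 = s b - t c and
    p0 = s a - t d.  In characteristic 3 its discriminant is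
    p1^2 p2^2 - p0 p2^3 - p1^3 p3, and the cubic is a cube exactly when
    p1 = p2 = 0.  The linear polynomials p1 and p2 in t are proportional exactly
    when b * s b = c * s c; for nonzero b this says that beta = s c / b is unitary.

    Suppose that they are not proportional.  The discriminant Delta(t) is then
    separable of degree 3 or 4 ([pencil_disc_coprime]).  If g is injective, then
    every unitary t has exactly one unitary preimage, and the way in which s
    permutes the roots of N - t D forces Delta(t) / t^2 to be a nonzero square
    of the subfield of order q ([twin_root], [disc_power]).  So
    X^2 Delta^((q-1)/2) - 1 is divisible by X^(q+1) - 1.  A curve of genus one
    is behind this, and the Hasse bound would rule it out; here the polynomial
    method of Stepanov does so directly ([separable_no_power_root]): in
    characteristic 3 the power Delta^((q-1)/2) satisfies a differential equation
    of order one with small coefficients, and differentiating the divisibility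
    relation leaves polynomials whose degrees are too small.  Hence
    b * s b = c * s c ([injective_norms]), and b <> 0 by separability.

    In the proportional case N - beta D = p3 (X - x0)^3 with x0 unitary
    ([totally_ramified_fibre]).  In the coordinate z = 1 / (x - x0) the map g is,
    up to a Moebius map of the target, the polynomial
    D(x0) z^3 + (c - b x0) z^2 + b z + a, and the unitary elements other than x0
    are the points k (y + r) of an affine line, with y fixed by s.  On such
    a line a nonzero quadratic term always creates a collision
    ([injective_no_quadratic_term]), so c = b x0, which says that x0 = alpha.
    What is left is y^3 - delta y up to scaling and translation, injective
    exactly when delta is not a square ([injective_nonsquare]).  The parameter r
    is any unitary element not fixed by s; the four cases of the theorem choose
    alpha, beta or gamma for it and for the corresponding parameter of the
    target, and each of the four quotients is delta ([quotient_ratio]). *)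

(** * Ring identities in characteristic 3 *)

Lemma three_multiples (R : pzRingType) (R3 : 3%:R = 0 :> R) :
  ((3%:R = 0 :> R) * (6%:R = 0 :> R) * (9%:R = 0 :> R) * (12%:R = 0 :> R))
  * ((- 3%:R = 0 :> R) * (- 6%:R = 0 :> R) * (- 9%:R = 0 :> R) * (- 12%:R = 0 :> R)).
Proof.
have mul3 k : (3 * k)%:R = 0 :> R by rewrite natrM R3 mul0r.
by do !split; rewrite ?(mul3 1) ?(mul3 2) ?(mul3 3) ?(mul3 4) ?oppr0.
Qed.

(** Normalisation with side equations only cancels a monomial whose coefficient
    is literally one of the given constants.  Hence all terms are first moved to
    one side, where coefficients that agree modulo 3 differ by a small multiple
    of 3, and all such multiples are supplied. *)
Ltac prepare3 R3 tac :=
  apply: subr0_eq;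
  let h1 := fresh in let h2 := fresh in let h3 := fresh in let h4 := fresh in
  let k1 := fresh in let k2 := fresh in let k3 := fresh in let k4 := fresh in
  case: (three_multiples R3) => [[[[h1 h2] h3] h4] [[[k1 k2] k3] k4]];
  tac h1 h2 h3 h4 k1 k2 k3 k4;
  clear h1 h2 h3 h4 k1 k2 k3 k4.

Ltac ring3 R3 :=
  prepare3 R3 ltac:(fun h1 h2 h3 h4 k1 k2 k3 k4 => ring : h1 h2 h3 h4 k1 k2 k3 k4).
Ltac field3 R3 :=
  prepare3 R3 ltac:(fun h1 h2 h3 h4 k1 k2 k3 k4 => field : h1 h2 h3 h4 k1 k2 k3 k4).

(** * Cubics and their polynomials *)

(** Used both with values [x] in a field and, with constant coefficients and
    ['X] for [x], for the polynomial itself. *)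
Definition cubic (R : nzRingType) (p3 p2 p1 p0 x : R) : R :=
  p3 * x ^+ 3 + p2 * x ^+ 2 + p1 * x + p0.

Lemma horner_cubic (K : fieldType) (k3 k2 k1 k0 x : K) :
  (cubic k3%:P k2%:P k1%:P k0%:P 'X).[x] = cubic k3 k2 k1 k0 x.
Proof. by rewrite /cubic !(hornerE, horner_exp). Qed.

Lemma size_cubic (K : fieldType) (k3 k2 k1 k0 : K) n :
    (3 - (k3 == 0%R) < n)%N -> (size (cubic k3%:P k2%:P k1%:P k0%:P 'X)%R <= n)%N.
Proof.
move=> le_n; apply/leq_sizeP => j le_nj.
rewrite /cubic !coefE; move: le_n le_nj.
case: eqP => [->|_] /=; case: j => [|[|[|[|j]]]] //=; rewrite ?subn0 ?subn1 ?mulr0 ?mul0r ?addr0 //=.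
all: by lia.
Qed.

Lemma cubic_eq0 (K : fieldType) (k3 k2 k1 k0 : K) :
  cubic k3%:P k2%:P k1%:P k0%:P 'X = 0 -> [/\ k3 = 0, k2 = 0, k1 = 0 & k0 = 0].
Proof.
move=> p0; split; [have := congr1 (coefp 3) p0 | have := congr1 (coefp 2) p0
  | have := congr1 (coefp 1) p0 | have := congr1 (coefp 0) p0];
  by rewrite /= /cubic !coefE /= !(mulr0, mulr1, addr0, add0r).
Qed.

Lemma deriv_cubic0 (K : fieldType) (k3 k0 : K) : 3%:R = 0 :> K ->
  (cubic k3%:P 0%:P 0%:P k0%:P 'X)^`() = 0.
Proof.
move=> K3; rewrite /cubic !mul_polyC !derivD !derivZ derivXn derivX !derivC /=.
by rewrite -scaler_nat K3 !scale0r scaler0 !addr0.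
Qed.

(** * The coordinate in which a totally ramified cubic is a polynomial *)

Section Twisted.
Variables (F : fieldType) (s : {rmorphism F -> F}).
Hypotheses (sK : involutive s) (F3 : 3%:R = 0 :> F).

(** For [s] of order two, [x * s x] is the norm to the fixed field of [s]. *)
Definition unitary (x : F) : Prop := x * s x = 1.

Lemma unitary_neq0 x : unitary x -> x != 0.
Proof. by move=> ux; apply: contra_eq_neq ux => ->; rewrite mul0r eq_sym oner_neq0. Qed.

Lemma unitary_conj x : unitary x -> s x = x^-1.
Proof. by move=> ux; rewrite -[LHS]mul1r -(mulVf (unitary_neq0 ux)) -mulrA ux mulr1. Qed.

Lemma conj_unitary x : x != 0 -> s x = x^-1 -> unitary x.
Proof. by move=> nz_x sx; rewrite /unitary sx mulfV. Qed.

(** The sum of two parameters of difference 1 on the line of unitary points that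
    produce equal values when the quadratic coefficient [e] is nonzero.  That the sum is
    fixed by [s], as two genuine parameters require, is where the hypotheses on
    the conjugates of all quantities enter. *)
Lemma fixed_midpoint x0 beta k e D0 b r :
    unitary x0 -> unitary beta -> k != 0 -> e != 0 ->
    s D0 = beta * D0 / x0 ^+ 3 -> s k = - x0 ^+ 2 * k -> s e = - beta / x0 * e ->
    s r = r + 1 / (x0 * k) -> s b = beta * (e + b * x0) ->
  s (- (b + D0 * k ^+ 2) / (e * k) + r) = - (b + D0 * k ^+ 2) / (e * k) + r.
Proof.
move=> /unitary_neq0 nx0 /unitary_neq0 nbeta nk ne sD0 sk se sr sb.
rewrite !(rmorphXn, fmorphV, rmorphD, rmorphN, rmorphM) /= sD0 sk se sr sb.
by field3 F3; rewrite !oppr_eq0 expf_neq0 ?nk ?ne ?nx0 ?nbeta.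
Qed.

Variables a b c d : F.
Let D := cubic a b c d.
Let N := cubic (s d) (s c) (s b) (s a).

Lemma conj_den x : unitary x -> s (D x) = x ^- 3 * N x.
Proof.
move=> ux; have nzx := unitary_neq0 ux.
rewrite /D /N /cubic !(rmorphD, rmorphXn, rmorphM) /= (unitary_conj ux).
by field.
Qed.

(** The fibre over [beta] is [x0] with multiplicity three. *)
Section TotallyRamified.
Variables (x0 beta p3 : F).
Hypotheses (ux0 : unitary x0) (ubeta : unitary beta).
Hypotheses (nz_b : b != 0) (sc : s c = beta * b).
Hypothesis nz_p3 : p3 != 0.
Hypothesis numE : forall x, N x = beta * D x + p3 * (x - x0) ^+ 3.
Hypothesis nz_den : forall x, unitary x -> D x != 0.

Let e := c - b * x0.
Let nz_x0 := unitary_neq0 ux0.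
Let nz_beta := unitary_neq0 ubeta.

Lemma conj_b : s b = beta * c.
Proof.
by apply: (can_inj sK); rewrite sK rmorphM /= sc (unitary_conj ubeta) mulKf.
Qed.

Lemma conj_den0 : s (D x0) = beta * D x0 / x0 ^+ 3.
Proof.
rewrite conj_den // numE subrr expr0n mulr0 addr0.
by rewrite mulrC.
Qed.

(** With [z = (x - x0)^-1], dividing the hypothesis [numE] by [D x] shows that
    the value at [x] determines and is determined by
    [D x / (x - x0) ^+ 3 = a + b * z + e * z ^+ 2 + D x0 * z ^+ 3]; the second
    alternative is the divided difference of this polynomial, simplified by
    the additivity of cubing. *)
Lemma collisionE x y : x != x0 -> y != x0 ->
  (N x * D y == N y * D x) =
  (x == y) || (b + e * ((x - x0)^-1 + (y - x0)^-1)
                + D x0 * ((x - x0)^-1 - (y - x0)^-1) ^+ 2 == 0).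
Proof.
move=> nx ny; have {}nx : x - x0 != 0 by rewrite subr_eq0.
have {}ny : y - x0 != 0 by rewrite subr_eq0.
move: nx ny (subrK x0 x) (subrK x0 y); move: (x - x0) (y - x0) => u v nu nv <- <-.
rewrite (inj_eq (addIr x0)) !numE !addrK -(subr_eq0 u) -(subr_eq0 (_ * _)).
have -> : (beta * D (u + x0) + p3 * u ^+ 3) * D (v + x0)
  - (beta * D (v + x0) + p3 * v ^+ 3) * D (u + x0)
  = p3 * (u ^+ 2 * v ^+ 2 * (u - v)) * (b + e * (u^-1 + v^-1) + D x0 * (u^-1 - v^-1) ^+ 2).
  by rewrite /D /cubic /e; field3 F3; rewrite nu nv.
by rewrite !(expf_eq0, mulf_eq0) (negPf nu) (negPf nv) (negPf nz_p3).
Qed.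

Variable r : F.
Hypothesis nfix_r : s r != r.

(** A Moebius map from the projective line over the fixed field of [s] onto the
    unitary elements, sending infinity to [x0]. *)
Definition line_point z := x0 * (z + s r) / (z + r).

Lemma line_den_neq0 z : s z = z -> z + r != 0.
Proof.
move=> sz; apply: contraNneq nfix_r => /eqP; rewrite addr_eq0 => /eqP zr.
by move: sz; rewrite zr rmorphN => /oppr_inj ->.
Qed.

Lemma line_pointB z : s z = z ->
  (line_point z - x0)^-1 = (z + r) / (x0 * (s r - r)).
Proof.
move=> sz; have nzr := line_den_neq0 sz.
have nsr : s r - r != 0 by rewrite subr_eq0.
have -> : line_point z - x0 = x0 * (s r - r) / (z + r).
  by rewrite /line_point; field.
by rewrite invf_div.
Qed.

Lemma line_point_neq z : s z = z -> line_point z != x0.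
Proof.
move=> sz; have nzr := line_den_neq0 sz.
have nsr : s r - r != 0 by rewrite subr_eq0.
rewrite -subr_eq0 -invr_eq0 line_pointB //.
by rewrite mulf_neq0 // invr_neq0 // mulf_neq0.
Qed.

Lemma line_point_unitary z : s z = z -> unitary (line_point z).
Proof.
move=> sz; have nzr := line_den_neq0 sz.
have nzsr : z + s r != 0.
  by rewrite -(inj_eq (can_inj sK)) rmorphD /= sK rmorph0 sz.
apply: conj_unitary; first by rewrite !mulf_neq0 // invr_neq0.
rewrite /line_point rmorphM fmorphV rmorphM !rmorphD /= sK sz (unitary_conj ux0).
by field; rewrite nz_x0 nzr nzsr.
Qed.

Lemma line_point_onto x : unitary x -> x != x0 ->
  exists2 z, s z = z & x = line_point z.
Proof.
move=> ux xx0; have nz_x := unitary_neq0 ux.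
have nx : x - x0 != 0 by rewrite subr_eq0.
have nsr : s r - r != 0 by rewrite subr_eq0.
exists ((x0 * s r - r * x) / (x - x0)).
  rewrite rmorphM fmorphV !rmorphB !rmorphM /= sK (unitary_conj ux) (unitary_conj ux0).
  by field; rewrite nx nz_x0 nz_x mulN1r subr_eq0 eq_sym.
rewrite /line_point.
have -> : (x0 * s r - r * x) / (x - x0) + s r = x * (s r - r) / (x - x0) by field.
have -> : (x0 * s r - r * x) / (x - x0) + r = x0 * (s r - r) / (x - x0) by field.
by field; rewrite nz_x0 nx nsr.
Qed.

(** Injectivity of [N x / D x] on the unitary elements, with denominators
    cleared. *)
Definition proj_injective :=
  forall x y, unitary x -> unitary y ->
    cubic (s d) (s c) (s b) (s a) x * cubic a b c d y =
    cubic (s d) (s c) (s b) (s a) y * cubic a b c d x -> x = y.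

(** If [e] is nonzero, the divided difference of [collisionE] is linear in the
    sum of the two parameters.  Fixing their difference to be 1, the equation can
    be solved for the sum, and the solution is fixed by [s]. *)
Lemma injective_no_quadratic_term : proj_injective -> e = 0.
Proof.
move=> injg; apply/eqP; apply: contraT => nz_e.
have nsr : s r - r != 0 by rewrite subr_eq0.
have nD0 := nz_den ux0.
pose k := (x0 * (s r - r))^-1.
have nk : k != 0 by rewrite invr_neq0 // mulf_neq0.
pose v := - (b + D x0 * k ^+ 2) / (e * k) + r.
have sk : s k = - x0 ^+ 2 * k.
  rewrite /k fmorphV rmorphM rmorphB /= sK (unitary_conj ux0); field.
  by rewrite nz_x0 nsr subr_eq0 eq_sym.
have se : s e = - beta / x0 * e.
  by rewrite /e rmorphB rmorphM /= sc conj_b (unitary_conj ux0); field.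
have sv : s v = v.
  have sr : s r = r + 1 / (x0 * k).
    by rewrite /k; field; rewrite nsr nz_x0 oner_neq0.
  have ce : c = e + b * x0 by rewrite /e; ring.
  have sb : s b = beta * (e + b * x0) by rewrite conj_b {1}ce.
  have sD0 := conj_den0.
  exact: (fixed_midpoint ux0 ubeta nk nz_e sD0 sk se sr sb).
(* The inverse of 2 is -1, so these have sum v and difference 1. *)
have fix1 : s (- (v + 1)) = - (v + 1) by rewrite rmorphN rmorphD rmorph1 /= sv.
have fix2 : s (1 - v) = 1 - v by rewrite rmorphB rmorph1 /= sv.
have /eqP coll : N (line_point (- (v + 1))) * D (line_point (1 - v))
   == N (line_point (1 - v)) * D (line_point (- (v + 1))).
  rewrite collisionE ?line_point_neq // !line_pointB // -/k.
  apply/orP; right; apply/eqP; rewrite /v.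
  by field3 F3; rewrite nz_e nk.
have /eqP := injg _ _ (line_point_unitary fix1) (line_point_unitary fix2) coll.
rewrite -(inj_eq (addIr (- x0))) -(inj_eq invr_inj) !line_pointB // -/k.
rewrite (inj_eq (mulIf nk)) (inj_eq (addIr r)) -subr_eq0.
have -> : - (v + 1) - (1 - v) = 1 by ring3 F3.
by rewrite oner_eq0.
Qed.

(** The constant delta for which, once [e] vanishes, the map becomes
    [z ^+ 3 - delta * z] up to scaling and translation. *)
Definition quad_ratio := - (b * x0 ^+ 2 * (r - s r) ^+ 2) / cubic a b c d x0.

Lemma quad_ratio_fixed : e = 0 -> s quad_ratio = quad_ratio.
Proof.
move/subr0_eq=> ce; have := conj_den0; have := nz_den ux0.
rewrite /quad_ratio -/(D x0); move: (D x0) => D0 nD0 sD0.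
rewrite !(rmorphXn, fmorphV, rmorphB, rmorphN, rmorphM) /= sK.
rewrite sD0 conj_b ce (unitary_conj ux0).
by field; rewrite nz_x0 nz_beta nD0.
Qed.

Lemma quad_ratio_neq0 : quad_ratio != 0.
Proof.
have nD0 := nz_den ux0.
rewrite mulf_neq0 ?invr_neq0 ?oppr_eq0 // !(expf_neq0, mulf_neq0) //.
by rewrite subr_eq0 eq_sym.
Qed.

(** Distinct parameters collide exactly when the square of their difference is
    [quad_ratio], and every element fixed by [s] is such a difference. *)
Lemma injective_nonsquare : e = 0 ->
  proj_injective <-> ~ exists2 z, s z = z & quad_ratio = z ^+ 2.
Proof.
move=> e0; have nD0 := nz_den ux0.
have nsr : s r - r != 0 by rewrite subr_eq0.
have key z1 z2 : s z1 = z1 -> s z2 = z2 ->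
    (N (line_point z1) * D (line_point z2) == N (line_point z2) * D (line_point z1))
     = (z1 == z2) || ((z1 - z2) ^+ 2 == quad_ratio).
  move=> f1 f2; rewrite collisionE ?line_point_neq // e0 mul0r addr0.
  rewrite -(inj_eq (addIr (- x0))) -(inj_eq invr_inj) !line_pointB //.
  have nk : (x0 * (s r - r))^-1 != 0 by rewrite invr_neq0 // mulf_neq0.
  rewrite (inj_eq (mulIf nk)) (inj_eq (addIr r)); congr orb.
  rewrite -[RHS]subr_eq0.
  have -> : (z1 - z2) ^+ 2 - quad_ratio =
    (b + D x0 * ((z1 + r) / (x0 * (s r - r)) - (z2 + r) / (x0 * (s r - r))) ^+ 2)
    * (x0 ^+ 2 * (r - s r) ^+ 2 / D x0).
    rewrite /quad_ratio -/(D x0); field.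
    by rewrite nz_x0 nD0 nsr.
  rewrite mulf_eq0 [X in _ || X]negbTE ?orbF //.
  rewrite mulf_neq0 ?invr_neq0 // !(expf_neq0, mulf_neq0) //.
  by rewrite -opprB oppr_eq0.
split=> [injg [z fz qz]|nsq x y ux uy].
  have f0 : s 0 = 0 by exact: rmorph0.
  have := key _ _ fz f0; rewrite subr0 -qz eqxx orbT => /eqP.
  move=> /(injg _ _ (line_point_unitary fz) (line_point_unitary f0)) /eqP.
  rewrite -(inj_eq (addIr (- x0))) -(inj_eq invr_inj) !line_pointB //.
  have nk : (x0 * (s r - r))^-1 != 0 by rewrite invr_neq0 // mulf_neq0.
  rewrite (inj_eq (mulIf nk)) (inj_eq (addIr r)) => /eqP z0.
  by have := quad_ratio_neq0; rewrite qz z0 expr0n eqxx.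
(* No other point lies over the value beta taken at x0. *)
have num0 w : N x0 * D w = N w * D x0 -> w = x0.
  rewrite !numE subrr expr0n mulr0 addr0 => /eqP.
  rewrite -subr_eq0.
  have -> : beta * D x0 * D w - (beta * D w + p3 * (w - x0) ^+ 3) * D x0
    = - (p3 * (w - x0) ^+ 3 * D x0) by ring.
  rewrite oppr_eq0 !(expf_eq0, mulf_eq0) (negPf nD0) (negPf nz_p3) /= orbF subr_eq0.
  by move/eqP.
have [-> /num0 -> //|xx0] := eqVneq x x0.
have [-> /esym /num0 // |yx0] := eqVneq y x0.
have [z1 f1 ->] := line_point_onto ux xx0.
have [z2 f2 ->] := line_point_onto uy yx0.
move=> /eqP; rewrite key // => /orP[/eqP-> //|/eqP qz].
case: nsq; exists (z1 - z2); last by rewrite qz.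
by rewrite rmorphB /= f1 f2.
Qed.

End TotallyRamified.
End Twisted.

(** * The polynomial method of Stepanov *)

Section Stepanov.
Variables (F : fieldType) (q k : nat).
Hypotheses (F3 : 3%:R = 0 :> F) (qE : q = k.*2.+1) (k1 : k%:R = 1 :> F).

Lemma polyF3 : 3%:R = 0 :> {poly F}.
Proof. by rewrite -[LHS]polyC_natr F3. Qed.

Lemma natr_poly1 : k%:R = 1 :> {poly F}.
Proof. by rewrite -[LHS]polyC_natr k1. Qed.

Lemma Xderiv_Xn1 : 'X * ('X^(q.+1) - 1 : {poly F})^`() = ('X^(q.+1) - 1) + 1.
Proof.
rewrite derivB derivXn derivC subr0 subrK -mulr_natr mulrA -exprS.
have -> : q.+1%:R = 1 :> {poly F}; last by rewrite mulr1.
rewrite qE -addn2 natrD -addnn natrD natr_poly1.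
by ring3 polyF3.
Qed.

(** Since [k] is 1 in [F], the logarithmic derivative of [D ^+ k] is that of
    [D]: the large exponent disappears from the differential equation. *)
Lemma Xderiv_twist (D : {poly F}) : (0 < k)%N ->
  'X * D * ('X^2 * D ^+ k)^`() = ('X * D^`() - D) * ('X^2 * D ^+ k).
Proof.
move=> k0; rewrite derivM derivXn deriv_exp /= -[_ *+ k]mulr_natr natr_poly1 mulr1.
have -> : D ^+ k = D * D ^+ k.-1 by rewrite -exprS prednK.
move: (D ^+ k.-1) D^`() => P D1.
by ring3 polyF3.
Qed.

Variable D : {poly F}.
Hypotheses (sD5 : (size D <= 5)%N) (sD4 : (4 <= size D)%N).
Hypotheses (sepD : coprimep D D^`()).

(** Write E for [X^(q+1) - 1] and [X^2 D^k = 1 + E S].  The differential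
    equation of the left side turns into [D S = E R + X D' - D], and comparing
    sizes shows that R has degree at most 2.  Differentiating once more and
    eliminating S gives an identity between [E X (D R)'] and a polynomial of
    degree at most 8, so [(D R)' = 0].  As D is prime to D', it divides R, which
    is too small: [R = 0].  Then D divides [X D'], hence X, which is too small
    again. *)
Lemma separable_no_power_root : (8 <= q)%N ->
  ~ ('X^(q.+1) - 1 %| 'X^2 * D ^+ k - 1).
Proof.
move=> q8 /dvdpP[S]; set E := 'X^(q.+1) - 1; rewrite [S * E]mulrC => TS.
have k0 : (0 < k)%N by case: (k) qE q8 => [->|].
have nzD : D != 0 by rewrite -size_poly_eq0; case: (size D) sD4.
have {}TS : 'X^2 * D ^+ k = 1 + E * S by rewrite -TS addrC subrK.
have szE : size E = q.+2 by rewrite size_XnsubC.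
have nzE : E != 0 by rewrite -size_poly_eq0 szE.
have sS : (size S <= q)%N.
  have [->|nzS] := eqVneq S 0; first by rewrite size_poly0.
  have szES : (size (E * S)%R <= q.*2.+1)%N.
    have -> : E * S = 'X^2 * D ^+ k - 1 by rewrite TS addrC addKr.
    rewrite (leq_trans (size_polyD _ _)) // geq_max size_polyN size_poly1 andbT.
    rewrite mulrC size_mulXn ?expf_neq0 //.
    rewrite (leq_trans (leq_add (leqnn 2) (size_poly_exp_leq _ _))) //.
    have : ((size D).-1 * k <= 4 * k)%N by rewrite leq_mul2r -subn1 leq_subLR sD5 orbT.
    by rewrite qE; move: (_.-1 * k)%N => w; lia.
  by move: szES; rewrite size_mul // szE; move: (size _) => n; clear; lia.
pose R := 'X * D^`() * S - 2%:R * D * S - 'X * D * S^`().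
have XE' := Xderiv_Xn1; rewrite -/E in XE'.
have DS : D * S = E * R + 'X * D^`() - D.
  have := Xderiv_twist D k0; rewrite TS derivD derivC add0r derivM => H.
  have {}H : D * ('X * E^`()) * S + 'X * D * E * S^`() = ('X * D^`() - D) * (1 + E * S).
    by rewrite -H; ring.
  move: H; rewrite XE' => /eqP; rewrite -subr_eq0 => /eqP H.
  by apply: subr0_eq; rewrite /R -H; ring.
have sD' : (size D^`() <= 4)%N by rewrite -ltnS (leq_trans (lt_size_deriv nzD)).
have sXD' : (size ('X * D^`())%R <= 5)%N.
  by rewrite (leq_trans (size_polyMleq _ _)) // size_polyX.
have nz_mulE (A : {poly F}) n : (size (E * A)%R <= n)%N -> A != 0 -> (q.+1 + size A <= n)%N.
  by move=> szA nzA; move: szA; rewrite size_mul // szE addSn.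
have sR : (size R <= 3)%N.
  have [->|nzR] := eqVneq R 0; first by rewrite size_poly0.
  suff : (q.+1 + size R <= q + 4)%N by lia.
  apply: nz_mulE nzR.
  have -> : E * R = D * S - 'X * D^`() + D by rewrite DS; ring.
  rewrite (leq_trans (size_polyD _ _)) // geq_max (leq_trans sD5) ?andbT; last by lia.
  rewrite (leq_trans (size_polyD _ _)) // geq_max size_polyN (leq_trans sXD') ?andbT; last by lia.
  rewrite (leq_trans (size_polyMleq _ _)) //; move: sD5 sS.
  by move: (size D) (size S) => u v; clear; lia.
have DR' : E * ('X * (D * R)^`()) =
    D * R - ('X * D^`() - D) ^+ 2 - 'X^2 * D * D^`()^`().
  have DS' : D^`() * S + D * S^`() = E^`() * R + E * R^`() + 'X * D^`()^`().
    move: (congr1 (@deriv F) DS).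
    rewrite derivB derivD (derivM D) (derivM E) (derivM 'X) derivX mul1r => ->.
    by ring.
  have e1 : D * R = ('X * D^`() - 2%:R * D) * (D * S) - 'X * D * (D * S^`()).
    by rewrite /R; ring.
  have e2 : D * S^`() = E^`() * R + E * R^`() + 'X * D^`()^`() - D^`() * S.
    by rewrite -DS'; ring.
  have e3 : D * R = (2%:R * 'X * D^`() - 2%:R * D) * (D * S)
     - D * (('X * E^`()) * R + 'X * E * R^`() + 'X^2 * D^`()^`()).
    by rewrite e1 e2; ring.
  move: e3; rewrite DS XE' derivM; move: R^`() D^`()^`() D^`() => R1 D2 D1 e3.
  rewrite -[RHS]addr0 -(subrr (D * R)) {3}e3.
  by ring3 polyF3.
have DR0 : (D * R)^`() = 0.
  apply/eqP; apply: contraT => nz.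
  have : (q.+1 + size ('X * (D * R)^`())%R <= 9)%N.
    apply: nz_mulE; last by rewrite mulf_neq0 // polyX_eq0.
    rewrite DR' -addrA -opprD (leq_trans (size_polyD _ _)) // geq_max size_polyN.
    apply/andP; split.
      rewrite (leq_trans (size_polyMleq _ _)) //; move: sD5 sR.
      by move: (size D) (size R) => u v; clear; lia.
    rewrite (leq_trans (size_polyD _ _)) // geq_max; apply/andP; split.
      have sXB : (size ('X * D^`() - D)%R <= 5)%N.
        by rewrite (leq_trans (size_polyD _ _)) // geq_max size_polyN sXD'.
      rewrite (leq_trans (size_poly_exp_leq _ _)) //; move: sXB.
      by move: (size _) => u; clear; lia.
    have sD'' : (size D^`()^`() <= 3)%N.
      have [->|nzD'] := eqVneq D^`() 0; first by rewrite deriv0 size_poly0.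
      by rewrite -ltnS (leq_trans (lt_size_deriv nzD')).
    rewrite -mulrA mulrC (leq_trans (size_polyMleq _ _)) // size_polyXn.
    have := size_polyMleq D D^`()^`(); move: sD5 sD''.
    by move: (size _) (size _) (size _) => u v w; clear; lia.
  have : (0 < size ('X * (D * R)^`())%R)%N by rewrite size_poly_gt0 mulf_neq0 // polyX_eq0.
  by lia.
have R0 : R = 0.
  apply/eqP; apply: contraT => nzR.
  have : D %| R.
    rewrite -(Gauss_dvdpr _ sepD).
    move: DR0; rewrite derivM => /eqP; rewrite addr_eq0 => /eqP ->.
    by rewrite -mulrN dvdp_mulr.
  move/(dvdp_leq nzR) => sDR.
  by have := leq_trans sD4 (leq_trans sDR sR).
move: DS; rewrite R0 mulr0 add0r => DS.
have : D %| 'X.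
  rewrite -(Gauss_dvdpl _ sepD).
  have -> : 'X * D^`() = D * (S + 1) by rewrite mulrDr DS; ring.
  by rewrite dvdp_mulr.
move/dvdp_leq; rewrite polyX_eq0 size_polyX => /(_ isT) sDX.
by have := leq_trans sD4 sDX.
Qed.
End Stepanov.

(** For q = 3 the degrees leave room for solutions.  Comparing coefficients
    leaves [D = s X^4 + X^2 - s]; the relation between the extreme coefficients
    gives [s^2 = -1], and then D is [s (X^2 + s)^2]. *)
Lemma separable_no_power_root3 (F : fieldType) (D : {poly F}) :
    3%:R = 0 :> F -> (size D <= 5)%N -> (4 <= size D)%N -> D`_0 = D`_4 ^+ 3 -> coprimep D D^`() ->
  ~ ('X^4 - 1 %| 'X^2 * D - 1).
Proof.
move=> F3 sD sD4 D04 coD /dvdpP[S DS].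
have sS : (size S <= 3)%N.
  have [->|nzS] := eqVneq S 0; first by rewrite size_poly0.
  have : (size (S * ('X^4 - 1))%R <= 7)%N.
    rewrite -DS (leq_trans (size_polyD _ _)) // geq_max size_polyN size_poly1 andbT.
    rewrite (leq_trans (size_polyMleq _ _)) // size_polyXn.
    by move: sD; case: (size D) => [|[|[|[|[|[]]]]]].
  rewrite size_mul //; last by rewrite -size_poly_eq0 size_XnsubC.
  by rewrite size_XnsubC // addnC; case: (size S) => [|[|[|[|]]]].
have S0 i : S`_i.+3 = 0 by rewrite nth_default // (leq_trans sS).
have D0 i : D`_i.+1.+4 = 0 by rewrite nth_default // (leq_trans sD).
have cDS i : ('X^2 * D - 1)`_i = (S * ('X^4 - 1))`_i by rewrite DS.
have {cDS} cDS i : (if (i < 2)%N then 0 else D`_(i - 2)) - (i == 0%N)%:R =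
    (if (i < 4)%N then 0 else S`_(i - 4)) - S`_i.
  by move: (cDS i); rewrite mulrBr mulr1 !(coefB, coefXnM, coefMXn, coef1).
move: (cDS 0%N) (cDS 1%N) (cDS 2%N) (cDS 3%N) (cDS 4%N) (cDS 5%N) (cDS 6%N).
rewrite /= !S0 !subr0 !sub0r.
rewrite -[(3 - 2)%N]/1%N -[(4 - 2)%N]/2%N -[(5 - 2)%N]/3%N -[(6 - 2)%N]/4%N.
rewrite -[(4 - 4)%N]/0%N -[(5 - 4)%N]/1%N -[(6 - 4)%N]/2%N -[(2 - 2)%N]/0%N.
move=> /oppr_inj e0 /esym/eqP; rewrite oppr_eq0 => /eqP e1 e2 e3 e4 e5 e6.
move: D04; rewrite e2 e6; set s := S`_2 => s3.
have DE : D = s *: 'X^4 + 'X^2 - s%:P.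
  apply/polyP => i; rewrite !coefE.
  by case: i => [|[|[|[|[|i]]]]] /=; rewrite ?D0 ?e2 ?e3 ?e4 ?e5 ?e6 -?e0 ?e1;
    rewrite ?(mulr0, mulr1, addr0, add0r, subr0, sub0r, oppr0).
have nz_s : s != 0.
  by apply: contraTneq sD4; rewrite DE => ->; rewrite scale0r add0r subr0 size_polyXn.
have s2 : s ^+ 2 = - 1 by apply: (mulfI nz_s); rewrite -exprS -s3 mulrN1.
pose U := 'X^2 + s%:P : {poly F}.
have P3 := polyF3 F3.
have sP : s%:P ^+ 2 = -1 :> {poly F} by rewrite -rmorphXn s2 rmorphN rmorph1.
have UD : U %| D.
  apply/dvdpP; exists (s *: U).
  rewrite DE -!mul_polyC /U.
  have -> : s%:P * 'X^4 + 'X^2 - s%:P =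
     s%:P * 'X^4 - s%:P ^+ 2 * 'X^2 + s%:P * s%:P ^+ 2 :> {poly F} by rewrite sP; ring.
  by ring3 P3.
have UD' : U %| D^`().
  apply/dvdpP; exists (s *: 'X).
  rewrite DE !(derivB, derivD) derivZ !derivXn derivC -!mul_polyC /U /=.
  have -> : s%:P * 'X * ('X^2 + s%:P) = s%:P * 'X^3 + s%:P ^+ 2 * 'X :> {poly F} by ring.
  by rewrite sP; ring3 P3.
have : U %| 1.
  rewrite -(eqp_dvdr _ (_ : gcdp D D^`() %= 1)); last by rewrite gcdp_eqp1.
  by rewrite dvdp_gcd UD.
rewrite dvdp1 /U size_polyDl ?size_polyXn // size_polyC.
by case: (s != 0).
Qed.

(** * Roots of a self-conjugate cubic *)

(** The discriminant of a cubic in characteristic 3. *)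
Definition cubic_disc (R : nzRingType) (p3 p2 p1 p0 : R) : R :=
  p1 ^+ 2 * p2 ^+ 2 - p0 * p2 ^+ 3 - p1 ^+ 3 * p3.

Section TwinRoot.
Variables (F : fieldType) (s : {rmorphism F -> F}).
Hypotheses (sK : involutive s) (F3 : 3%:R = 0 :> F).

(** The hypotheses on [s p3] and [s p2] say that [x |-> (s x)^-1] permutes the
    roots.  It fixes the given root [x].  The roots of the quadratic cofactor are
    [(k1 + rho) / p3] and [(k1 - rho) / p3], where [rho] is a square root of its
    discriminant; the map fixes both when [s u = - u] and would exchange them if
    [s u] were [u].  When [u] is 0, two of the three roots coincide and all are
    unitary. *)
Lemma twin_root p3 p2 p1 p0 t x u :
    unitary s t -> unitary s x -> s p3 = - p0 / t -> s p2 = - p1 / t ->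
    p2 != 0 -> cubic p3 p2 p1 p0 x = 0 ->
    cubic_disc p3 p2 p1 p0 = (u * t) ^+ 2 -> s u = - u ->
  exists y, [/\ unitary s y, y != x & cubic p3 p2 p1 p0 y = 0].
Proof.
move=> ut ux sp3 sp2 nz_p2 root_x discE su.
have nt := unitary_neq0 ut; have nx := unitary_neq0 ux.
have sp1 : s p1 = - p2 / t.
  apply: (can_inj sK); rewrite sK rmorphM rmorphN fmorphV /= sp2 (unitary_conj ut).
  by field; rewrite nt oner_neq0.
have sp0 : s p0 = - p3 / t.
  apply: (can_inj sK); rewrite sK rmorphM rmorphN fmorphV /= sp3 (unitary_conj ut).
  by field; rewrite nt oner_neq0.
have nz_p1 : p1 != 0.
  by apply: contraNneq nz_p2 => p10; rewrite -(inj_eq (can_inj sK)) sp2 p10 rmorph0 oppr0 mul0r.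
have p0E : p0 = - (p3 * x ^+ 3 + p2 * x ^+ 2 + p1 * x).
  by apply/eqP; rewrite -addr_eq0 addrC; apply/eqP.
(* With roots 0 and infinity, the discriminant is (p1 * p2)^2, and
   p1 * p2 / t is fixed by s. *)
have [p3_0 | nz_p3] := eqVneq p3 0.
  have p0_0 : p0 = 0.
    have: s p3 = 0 by rewrite p3_0 rmorph0.
    by rewrite sp3 => /eqP; rewrite mulf_eq0 invr_eq0 (negPf nt) orbF oppr_eq0 => /eqP.
  have : (p1 * p2) ^+ 2 = (u * t) ^+ 2.
    by rewrite -discE /cubic_disc p3_0 p0_0; ring.
  have fix12 : s (p1 * p2 / t) = p1 * p2 / t.
    rewrite !(fmorphV, rmorphM) /= sp1 sp2 (unitary_conj ut).
    by field; rewrite nt oner_neq0.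
  move/eqP; rewrite eqf_sqr => H.
  have u0 : u = 0.
    have su' : s u = u.
      case/orP: H => /eqP H.
        by rewrite -[u](mulfK nt) -H fix12.
      by rewrite -[u](mulfK nt) -[u * t]opprK -H mulNr rmorphN fix12.
    rewrite su' in su.
    have : u + u = 0 by rewrite {1}su addNr.
    have -> : u + u = - u by ring3 F3.
    by move/eqP; rewrite oppr_eq0 => /eqP.
  move: H; rewrite u0 mul0r oppr0 orbb mulf_eq0.
  by rewrite (negPf nz_p1) (negPf nz_p2).
have nz_p0 : p0 != 0.
  by apply: contraNneq nz_p3 => p00; rewrite -(inj_eq (can_inj sK)) sp3 p00 rmorph0 oppr0 mul0r.
(* The derivative at x is p1 - p2 * x. *)
have [double | simple] := eqVneq p1 (p2 * x).
  have p0E' : p0 = - x ^+ 2 * (p3 * x - p2) by rewrite p0E double; ring3 F3.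
  have nz_y : p3 * x - p2 != 0.
    by apply: contraNneq nz_p0; rewrite p0E' => ->; rewrite mulr0.
  exists (x - p2 / p3); split.
  - apply: conj_unitary.
      have -> : x - p2 / p3 = (p3 * x - p2) / p3 by field.
      by rewrite mulf_neq0 // invr_neq0.
    rewrite !(fmorphV, rmorphB, rmorphM) /= sp2 sp3 (unitary_conj ux) double p0E'.
    field; rewrite oppr_eq0 [x * p3]mulrC nt nx nz_y nz_p3 /= andbT.
    by rewrite mulf_neq0 // oppr_eq0 expf_neq0.
  - rewrite -subr_eq0 addrAC subrr add0r oppr_eq0.
    by rewrite mulf_neq0 // invr_neq0.
  - rewrite /cubic p0E' double.
    by field3 F3.
have nz_dif : p1 - p2 * x != 0 by rewrite subr_eq0.
pose k1 := p2 + p3 * x; pose k0 := p1 + p2 * x + p3 * x ^+ 2.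
have nz_k0 : k0 != 0.
  apply: contraNneq nz_p0 => k00; rewrite p0E.
  have -> : - (p3 * x ^+ 3 + p2 * x ^+ 2 + p1 * x) = - x * k0 by rewrite /k0; ring.
  by rewrite k00 mulr0.
pose rho := u * t / (p1 - p2 * x).
have rho2 : rho ^+ 2 = k1 ^+ 2 - p3 * k0.
  rewrite /rho expr_div_n -discE; apply: (mulIf (expf_neq0 2 nz_dif)).
  rewrite mulfVK ?expf_neq0 // /cubic_disc p0E /k1 /k0.
  by ring3 F3.
exists ((k1 + rho) / p3).
have sk1 : s k1 = x * k1 / t.
  rewrite /k1 rmorphD rmorphM /= sp2 sp3 (unitary_conj ux) p0E.
  by field; rewrite nx nt.
have srho : s rho = - rho * x / t.
  rewrite /rho !(fmorphV, rmorphB, rmorphM) /= su sp1 sp2 (unitary_conj ux) (unitary_conj ut).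
  by field; rewrite nt nz_dif nx.
have sp3' : s p3 = k0 * x / t by rewrite sp3 p0E /k0; field.
have Ky : p3 * ((k1 + rho) / p3) ^+ 2 + k1 * ((k1 + rho) / p3) + k0 = 0.
  apply: (mulfI nz_p3); rewrite mulr0.
  have -> : p3 * (p3 * ((k1 + rho) / p3) ^+ 2 + k1 * ((k1 + rho) / p3) + k0)
    = 2%:R * k1 ^+ 2 + 3%:R * k1 * rho + rho ^+ 2 + p3 * k0 by field.
  by rewrite rho2; ring3 F3.
have ny : (k1 + rho) / p3 != x.
  apply: contraNneq nz_dif => yx; move: Ky; rewrite yx => Ky.
  by apply/eqP; rewrite -[RHS]Ky /k1 /k0; ring3 F3.
split=> //.
  apply/eqP; rewrite /unitary rmorphM fmorphV rmorphD /= sk1 srho sp3'.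
  have -> : (k1 + rho) / p3 * ((x * k1 / t + - rho * x / t) / (k0 * x / t))
     = (k1 ^+ 2 - rho ^+ 2) / (p3 * k0).
    by field; rewrite nz_k0 nx nt nz_p3.
  by rewrite rho2 opprB addrC subrK divff // mulf_neq0.
move: Ky; move: ((k1 + rho) / p3) => y Ky.
have -> : cubic p3 p2 p1 p0 y = (y - x) * (p3 * y ^+ 2 + k1 * y + k0).
  by rewrite /cubic /k1 /k0 p0E; ring.
by rewrite Ky mulr0.
Qed.
End TwinRoot.

(** * The discriminant of the pencil N - t D *)

Section Pencil.
Variables (F : fieldType) (s : {rmorphism F -> F}).
Hypotheses (sK : involutive s) (F3 : 3%:R = 0 :> F).
Variables a b c d : F.

Definition pencil (u v : F) : {poly F} := (s u)%:P - v%:P * 'X.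

Definition pencil_disc : {poly F} :=
  cubic_disc (pencil d a) (pencil c b) (pencil b c) (pencil a d).

Lemma horner_pencil u v t : (pencil u v).[t] = s u - v * t.
Proof. by rewrite /pencil !hornerE. Qed.

Lemma horner_pencil_disc t : pencil_disc.[t] =
  cubic_disc (s d - a * t) (s c - b * t) (s b - c * t) (s a - d * t).
Proof. by rewrite /pencil_disc /cubic_disc !(hornerE, horner_exp, horner_pencil). Qed.

Lemma pencil_discE : pencil_disc =
  (b ^+ 2 * c ^+ 2 - d * b ^+ 3 - a * c ^+ 3)%:P * 'X^4
  + (b * c * (b * s b + c * s c) + s a * b ^+ 3 + c ^+ 3 * s d)%:P * 'X^3
  + ((b * s b + c * s c) ^+ 2 + 2%:R * b * c * s b * s c)%:P * 'X^2
  + (s b * s c * (b * s b + c * s c) + d * s c ^+ 3 + a * s b ^+ 3)%:P * 'X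
  + (s b ^+ 2 * s c ^+ 2 - s a * s c ^+ 3 - s b ^+ 3 * s d)%:P.
Proof.
rewrite /pencil_disc /cubic_disc /pencil.
rewrite !(polyCD, polyCN, polyCM, polyC_exp, polyC_natr).
by ring3 (polyF3 F3).
Qed.

Definition homog (R : nzRingType) (p3 p2 p1 p0 x y : R) : R :=
  p3 * x ^+ 3 + p2 * x ^+ 2 * y + p1 * x * y ^+ 2 + p0 * y ^+ 3.

(** The partial derivatives of the homogeneous cubic vanish at (p1, p2) in
    characteristic 3, so only the explicit dependence on [t] contributes to the
    derivative of the expression in [pencil_disc_homog]. *)
Lemma pencil_disc_deriv : pencil_disc^`() =
  homog a%:P b%:P c%:P d%:P (pencil b c) (pencil c b).
Proof.
have dpencil u v : (pencil u v)^`() = - v%:P.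
  by rewrite /pencil derivB derivC sub0r derivM derivC mul0r add0r derivX mulr1.
rewrite /pencil_disc /cubic_disc !(derivB, derivD, derivM, deriv_exp, dpencil) /=.
rewrite /homog; move: (pencil d a) (pencil c b) (pencil b c) (pencil a d) => P3 P2 P1 P0.
rewrite !(derivC, derivX, mul0r, sub0r, mulr1).
by ring3 (polyF3 F3).
Qed.

(** The only critical point of [p3 x^3 + p2 x^2 + p1 x + p0] is [p1 / p2], and
    the discriminant is, up to a factor, its value there. *)
Lemma pencil_disc_homog : - pencil_disc =
  homog (s d)%:P (s c)%:P (s b)%:P (s a)%:P (pencil b c) (pencil c b)
  - 'X * homog a%:P b%:P c%:P d%:P (pencil b c) (pencil c b).
Proof.
rewrite /pencil_disc /cubic_disc /homog.
have E u v : (s u)%:P = pencil u v + v%:P * 'X by rewrite /pencil subrK.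
rewrite {1}(E d a) {1}(E c b) {1}(E b c) {1}(E a d).
by ring3 (polyF3 F3).
Qed.

Lemma size_pencil_disc : (size pencil_disc <= 5)%N.
Proof.
apply/leq_sizeP => -[|[|[|[|[|j]]]]] // _.
by rewrite pencil_discE !coefE /= !(mulr0, addr0).
Qed.

Lemma pencil_disc_coef0 : pencil_disc`_0 = s pencil_disc`_4.
Proof.
rewrite pencil_discE !coefE /= !(mulr0, mulr1, addr0, add0r).
by rewrite !(rmorphXn, rmorphB, rmorphM) /=; ring.
Qed.

Lemma pencil_disc_coef1 : pencil_disc`_1 = s pencil_disc`_3.
Proof.
rewrite pencil_discE !coefE /= !(mulr0, mulr1, addr0, add0r).
by rewrite !(rmorphXn, rmorphD, rmorphM) /= !sK; ring.
Qed.

(** The coefficients are conjugate in pairs, so if the two highest ones vanish,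
    then the discriminant is a multiple of [X^2]. *)
Lemma size_pencil_disc_ge : coprimep pencil_disc pencil_disc^`() ->
  (4 <= size pencil_disc)%N.
Proof.
move=> co; rewrite ltnNge; apply/negP => sz.
have c4 : pencil_disc`_4 = 0 by rewrite nth_default // (leq_trans sz).
have c3 : pencil_disc`_3 = 0 by rewrite nth_default // (leq_trans sz).
have c1 := pencil_disc_coef1; have c0 := pencil_disc_coef0.
rewrite c3 rmorph0 in c1; rewrite c4 rmorph0 in c0.
have E : pencil_disc = pencil_disc`_2 *: 'X^2.
  apply/polyP => i; rewrite coefZ coefXn.
  case: i => [|[|[|i]]] /=; rewrite ?c1 ?c0 ?mulr0 ?mulr1 //.
  by rewrite nth_default // (leq_trans sz).
move: co; rewrite E derivZ derivXn /= => co.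
have : 'X %| (1 : {poly F}).
  have X1 : 'X %| pencil_disc`_2 *: 'X^2 by rewrite -mul_polyC mulrA dvdp_mulIr.
  have X2 : 'X %| pencil_disc`_2 *: 'X *+ 2 by rewrite -mul_polyC -mulrnAl dvdp_mulIr.
  rewrite -(eqp_dvdr _
    (_ : gcdp (pencil_disc`_2 *: 'X^2) (pencil_disc`_2 *: ('X *+ 2)) %= 1)).
    by rewrite dvdp_gcd X1 -scalerMnr X2.
  by rewrite gcdp_eqp1.
by rewrite dvdp1 size_polyX.
Qed.
End Pencil.

Lemma homog_coprime (K : fieldType) (n3 n2 n1 n0 d3 d2 d1 d0 x y : K) :
    coprimep (cubic n3%:P n2%:P n1%:P n0%:P 'X) (cubic d3%:P d2%:P d1%:P d0%:P 'X) ->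
    (n3 != 0) || (d3 != 0) ->
    homog n3 n2 n1 n0 x y = 0 -> homog d3 d2 d1 d0 x y = 0 ->
  x = 0 /\ y = 0.
Proof.
move=> coND lead hN hD.
have homogE k3 k2 k1 k0 : y != 0 -> homog k3 k2 k1 k0 x y = cubic k3 k2 k1 k0 (x / y) * y ^+ 3 :> K.
  by move=> nz_y; rewrite /homog /cubic; field.
have [y0 | nz_y] := eqVneq y 0.
  split=> //; apply/eqP; move: lead; apply: contraTT => nz_x.
  move: hN hD; rewrite /homog y0 !(expr0n, mulr0, addr0) /=.
  move=> /eqP + /eqP; rewrite !(expf_eq0, mulf_eq0) (negPf nz_x) /= !orbF.
  by move=> -> ->.
have nz_y3 : y ^+ 3 != 0 by rewrite expf_neq0.
move: hN hD; rewrite !homogE // => /eqP + /eqP.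
rewrite mulf_eq0 (negPf nz_y3) orbF -horner_cubic => rN.
rewrite mulf_eq0 (negPf nz_y3) orbF -horner_cubic => rD.
by have := coprimep_root coND rN; rewrite rD.
Qed.

(** At a common root [th] of the discriminant and its derivative, in an
    algebraic closure, the numerator and the denominator of [g] both vanish at
    the projective point (p1, p2); that this is a genuine point is the
    hypothesis on [b] and [c]. *)
Lemma pencil_disc_coprime (F : finFieldType) (s : {rmorphism F -> F})
    (a b c d : F) :
    3%:R = 0 :> F ->
    coprimep (cubic (s d)%:P (s c)%:P (s b)%:P (s a)%:P 'X)
             (cubic a%:P b%:P c%:P d%:P 'X) ->
    (s d != 0) || (a != 0) -> b * s b != c * s c ->
  coprimep (pencil_disc s a b c d) (pencil_disc s a b c d)^`().
Proof.
move=> F3 coND lead indep; have [K [iota _]] := countable_algebraic_closure F.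
apply: contraT; rewrite coprimep_def -(size_map_poly iota) => /closed_rootP[th].
rewrite gcdp_map root_gcd => /andP[/rootP rD /rootP rD'].
pose p1 := iota (s b) - iota c * th; pose p2 := iota (s c) - iota b * th.
have map_pencil u v : (map_poly iota (pencil s u v)).[th] = iota (s u) - iota v * th.
  by rewrite /pencil rmorphB rmorphM /= !map_polyC map_polyX !hornerE.
have map_homog_gen k3 k2 k1 k0 (P Q : {poly F}) :
    (map_poly iota (homog k3%:P k2%:P k1%:P k0%:P P Q)).[th]
    = homog (iota k3) (iota k2) (iota k1) (iota k0)
        (map_poly iota P).[th] (map_poly iota Q).[th].
  rewrite /homog !(rmorphXn, rmorphD, rmorphM) /= !map_polyC.
  by rewrite !(hornerE, horner_exp).
have map_homog k3 k2 k1 k0 :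
    (map_poly iota (homog k3%:P k2%:P k1%:P k0%:P (pencil s b c) (pencil s c b))).[th]
    = homog (iota k3) (iota k2) (iota k1) (iota k0) p1 p2.
  by rewrite map_homog_gen !map_pencil.
have hD : homog (iota a) (iota b) (iota c) (iota d) p1 p2 = 0.
  by rewrite -map_homog -pencil_disc_deriv // rD'.
have hN : homog (iota (s d)) (iota (s c)) (iota (s b)) (iota (s a)) p1 p2 = 0.
  rewrite -map_homog -[homog _ _ _ _ _ _](subrK
    ('X * homog a%:P b%:P c%:P d%:P (pencil s b c) (pencil s c b))).
  rewrite -pencil_disc_homog // -pencil_disc_deriv //.
  by rewrite rmorphD rmorphN rmorphM /= !hornerE rD rD' mulr0 oppr0 addr0.
have coK : coprimep
   (cubic (iota (s d))%:P (iota (s c))%:P (iota (s b))%:P (iota (s a))%:P 'X)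
   (cubic (iota a)%:P (iota b)%:P (iota c)%:P (iota d)%:P 'X).
  have mapC k3 k2 k1 k0 : cubic (iota k3)%:P (iota k2)%:P (iota k1)%:P (iota k0)%:P 'X
      = map_poly iota (cubic k3%:P k2%:P k1%:P k0%:P 'X).
    by rewrite /cubic !(rmorphXn, rmorphD, rmorphM) /= !map_polyC map_polyX.
  by rewrite !mapC coprimep_map.
have leadK : (iota (s d) != 0) || (iota a != 0) by rewrite ![iota _ == 0]fmorph_eq0.
have [] := homog_coprime coK leadK hN hD; rewrite /p1 /p2 => /subr0_eq p10 /subr0_eq p20.
move: indep; rewrite -(inj_eq (fmorph_inj iota)) !rmorphM /= p10 p20.
by rewrite mulrCA eqxx.
Qed.

(** * The quadratic extension of finite fields *)

Lemma dvdp_prod_root (K : fieldType) (I : Type) (r : seq I) (f : I -> K) (p : {poly K}) :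
  p %| \prod_(i <- r) ('X - (f i)%:P) -> size p != 1%N -> exists x, root p x.
Proof.
move=> /dvdp_prod_XsubC[msk pE] szp.
case: (mask msk r) pE => [|i r'] pE; last first.
  by exists (f i); rewrite (eqp_root pE) big_cons rootM root_XsubC eqxx.
by move: szp; rewrite (eqp_size pE) big_nil size_poly1.
Qed.

(** For nonzero [w] the exponent of [w ^+ ((#|F| - 1) / 2)] is a multiple of
    [q - 1], so [X^2 - w] divides [X^#|F| - X], which splits. *)
Lemma subfield_sqrt (F : finFieldType) (q k : nat) (w : F) :
  #|F| = (q ^ 2)%N -> q = k.*2.+1 -> w ^+ q = w -> exists u, w = u ^+ 2.
Proof.
move=> cF qE wq; have [->|nz_w] := eqVneq w 0; first by exists 0; rewrite expr0n.
have wk : w ^+ k.*2 = 1 by apply: (mulfI nz_w); rewrite -exprS -qE wq mulr1.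
have cFE : #|F| = (2 * (k.*2 * k.+1)).+1 by rewrite cF qE; lia.
have : 'X^2 - w%:P %| \prod_(x : F) ('X - x%:P).
  rewrite -finField_genPoly cFE.
  have -> n : 'X^(n.+1) - 'X = 'X * ('X^n - 1) :> {poly F} by rewrite exprS mulrBr mulr1.
  rewrite dvdp_mull //.
  have -> : 1 = w%:P ^+ (k.*2 * k.+1) :> {poly F}.
    by rewrite -rmorphXn exprM wk expr1n.
  by rewrite exprM subrXX dvdp_mulIl.
move/dvdp_prod_root; rewrite size_XnsubC // => /(_ isT)[u].
by rewrite /root !(hornerE, horner_exp) subr_eq0 => /eqP <-; exists u.
Qed.

Section FrobeniusPower.
Variables (F : finFieldType) (m q : nat).
Hypotheses (qE : q = (3 ^ m)%N) (F3 : 3%:R = 0 :> F).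

Definition frob (x : F) : F := x ^+ q.

Lemma frob_zmod : zmod_morphism frob.
Proof.
have q3 : [pchar F].-nat q.
  by rewrite qE pnatX pnatE // inE /= F3 eqxx.
move=> x y; apply/eqP; rewrite /frob eq_sym subr_eq.
by rewrite -exprDn_pchar // subrK.
Qed.

Lemma frob_monoid : monoid_morphism frob.
Proof. by split=> [|x y]; rewrite /frob ?expr1n ?exprMn. Qed.

HB.instance Definition _ := GRing.isZmodMorphism.Build F F frob frob_zmod.
HB.instance Definition _ := GRing.isMonoidMorphism.Build F F frob frob_monoid.

Lemma frobenius_rmorphism : exists s : {rmorphism F -> F}, forall x, s x = x ^+ q.
Proof. by exists frob. Qed.
End FrobeniusPower.

Lemma card_char3 (F : finFieldType) n : (0 < n)%N -> #|F| = (3 ^ n)%N -> 3%:R = 0 :> F.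
Proof.
move=> n0 cF; have := card_finPcharP cF (isT : prime 3).
by rewrite inE /= => /eqP.
Qed.

Section FiniteTwisted.
Variables (F : finFieldType) (m q : nat) (s : {rmorphism F -> F}).
Hypotheses (m0 : (0 < m)%N) (qE : q = (3 ^ m)%N) (cF : #|F| = (q ^ 2)%N).
Hypothesis sE : forall x, s x = x ^+ q.
Hypothesis F3 : 3%:R = 0 :> F.

Lemma frob_involutive : involutive s.
Proof. by move=> x; rewrite !sE -exprM mulnn -cF expf_card. Qed.

Lemma unitaryE x : unitary s x <-> x ^+ q.+1 = 1.
Proof. by rewrite /unitary sE -exprS. Qed.

Lemma mem_mu x : reflect (unitary s x) (x \in mu F q.+1).
Proof. by rewrite inE unity_rootE; apply: (iffP eqP) => /unitaryE. Qed.

Lemma mem_Fq x : (x \in Fq F q) = (s x == x).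
Proof. by rewrite inE sE. Qed.

Lemma cube_root y : exists x : F, y = x ^+ 3.
Proof.
exists (y ^+ (3 ^ (2 * m).-1)); rewrite -exprM -expnSr prednK; last by lia.
by rewrite mulnC expnM -qE -cF expf_card.
Qed.

Variables a b c d : F.
Let D := cubic a b c d.
Let N := cubic (s d) (s c) (s b) (s a).
Hypothesis coND : coprimep (cubic (s d)%:P (s c)%:P (s b)%:P (s a)%:P 'X)
                           (cubic a%:P b%:P c%:P d%:P 'X).
(** By [conj_den] a unitary zero of the denominator would be a zero of the
    numerator. *)
Lemma den_neq0 x : unitary s x -> D x != 0.
Proof.
move=> ux; apply/eqP => D0; have nx := unitary_neq0 ux.
have N0 : N x = 0.
  have := conj_den a b c d ux; rewrite -/(D x) -/(N x) D0 rmorph0.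
  by move/eqP; rewrite eq_sym mulf_eq0 invr_eq0 expf_eq0 (negPf nx) /= => /eqP.
have := coprimep_root coND; rewrite /root => /(_ x).
by rewrite !horner_cubic -/(N x) -/(D x) N0 D0 eqxx => /(_ isT).
Qed.

Lemma quotient_unitary x : unitary s x -> unitary s (N x / D x).
Proof.
move=> ux; have nx := unitary_neq0 ux; have nD := den_neq0 ux.
have sD : s (D x) = x ^- 3 * N x by exact: conj_den.
have sN : s (N x) = x ^- 3 * D x.
  have := congr1 s sD; rewrite frob_involutive !(fmorphV, rmorphXn, rmorphM) /=.
  rewrite (unitary_conj ux) => ->.
  by rewrite exprVn invrK mulrA mulVf ?mul1r // expf_neq0.
have nN : N x != 0.
  rewrite -(inj_eq (can_inj frob_involutive)) rmorph0 sN.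
  by rewrite mulf_eq0 invr_eq0 expf_eq0 negb_or nD andbT.
apply: conj_unitary; first by rewrite mulf_neq0 ?invr_neq0.
rewrite rmorphM fmorphV /= sD sN.
by field; rewrite nx nD nN.
Qed.

Lemma injective_onto t : proj_injective s a b c d -> unitary s t ->
  exists2 x, unitary s x & N x = t * D x.
Proof.
move=> injg ut; pose f x := N x / D x; pose M := mu F q.+1.
have fM : [set f x | x in M] \subset M.
  apply/subsetP => _ /imsetP[x /mem_mu ux ->].
  by apply/mem_mu; apply: quotient_unitary.
have f_inj : {in M &, injective f}.
  move=> x y /mem_mu ux /mem_mu uy /eqP; rewrite /f eqr_div ?den_neq0 // => /eqP.
  exact: injg.
have /eqP fE : [set f x | x in M] == M by rewrite eqEcard fM (card_in_imset f_inj) leqnn.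
have /imsetP[x /mem_mu ux ->] : t \in [set f x | x in M] by rewrite fE; apply/mem_mu.
by exists x; rewrite // /f divfK // den_neq0.
Qed.

(** By [twin_root] the discriminant is [(u * t) ^+ 2] with [u] nonzero and fixed
    by [s], so [u ^+ (q - 1) = 1]. *)
Lemma disc_power k t : q = k.*2.+1 -> b * s b != c * s c ->
    proj_injective s a b c d -> unitary s t ->
  t ^+ 2 * (pencil_disc s a b c d).[t] ^+ k = 1.
Proof.
move=> qk indep injg ut; have nt := unitary_neq0 ut; have sK := frob_involutive.
have [x ux Nx] := injective_onto injg ut.
rewrite horner_pencil_disc; set p3 := s d - a * t; set p2 := s c - b * t.
set p1 := s b - c * t; set p0 := s a - d * t.
have conj_pencil u v : s (s u - v * t) = - (s v - u * t) / t.
  by rewrite rmorphB rmorphM /= sK (unitary_conj ut); field.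
have sp3 : s p3 = - p0 / t by exact: conj_pencil.
have sp2 : s p2 = - p1 / t by exact: conj_pencil.
have sp1 : s p1 = - p2 / t by exact: conj_pencil.
have sp0 : s p0 = - p3 / t by exact: conj_pencil.
have nz_p2 : p2 != 0.
  apply: contraNneq indep => p20; have : s p2 = 0 by rewrite p20 rmorph0.
  rewrite sp2 => /eqP; rewrite mulf_eq0 invr_eq0 (negPf nt) orbF oppr_eq0 /p1.
  rewrite subr_eq0 => /eqP ->; move/subr0_eq: p20 => ->.
  by rewrite mulrCA.
have root_x : cubic p3 p2 p1 p0 x = 0.
  have -> : cubic p3 p2 p1 p0 x = N x - t * D x.
    by rewrite /p3 /p2 /p1 /p0 /N /D /cubic; ring.
  by rewrite Nx subrr.
set w := cubic_disc p3 p2 p1 p0.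
have sw : s (w / t ^+ 2) = w / t ^+ 2.
  have conj_disc k3 k2 k1 k0 :
      s (cubic_disc k3 k2 k1 k0) = cubic_disc (s k3) (s k2) (s k1) (s k0).
    by rewrite /cubic_disc !(rmorphXn, rmorphB, rmorphM).
  rewrite rmorphM fmorphV rmorphXn (unitary_conj ut) /= conj_disc sp3 sp2 sp1 sp0.
  by rewrite /w /cubic_disc; field; rewrite nt oner_neq0.
have [u wu] : exists u, w / t ^+ 2 = u ^+ 2.
  by apply: (subfield_sqrt cF qk); rewrite -sE.
have wE : w = (u * t) ^+ 2 by rewrite exprMn -wu divfK // expf_neq0.
have nsu : s u != - u.
  apply/eqP => su.
  have [y [uy yx root_y]] := twin_root sK F3 ut ux sp3 sp2 nz_p2 root_x wE su.
  case/eqP: yx; apply: injg => //.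
  have -> : cubic (s d) (s c) (s b) (s a) y = t * D y.
    by apply/subr0_eq; rewrite -root_y /p3 /p2 /p1 /p0 /D /cubic; ring.
  by rewrite -/(N x) -/(D x) Nx mulrAC.
have su : s u = u.
  have : (s u) ^+ 2 = u ^+ 2 by rewrite -rmorphXn -wu.
  by move/eqP; rewrite eqf_sqr (negPf nsu) orbF => /eqP.
have nz_u : u != 0 by apply: contraNneq nsu => ->; rewrite rmorph0 oppr0.
have uk : u ^+ k.*2 = 1 by apply: (mulfI nz_u); rewrite -exprS -qk -sE su mulr1.
rewrite wE -exprM mul2n exprMn uk mul1r -exprD.
by have -> : (2 + k.*2)%N = q.+1; [rewrite qk | apply/unitaryE].
Qed.
End FiniteTwisted.

(** * Reduced forms and separability of rational functions *)

Section ReducedForm.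
Variable K : fieldType.
Local Open Scope quotient_scope.

Lemma frac_repr (g : {fraction {poly K}}) :
  g = (\n_(repr g))%:F / (\d_(repr g))%:F.
Proof.
have nd : (\d_(repr g))%:F != 0 by rewrite tofrac_eq0 denom_ratioP.
apply: (mulIf nd); rewrite divfK //; move: (repr g) (reprK g) => x <-.
unlock tofrac; rewrite -[LHS]FracField.pi_mul; apply/eqmodP.
have nx : \d_x != 0 by exact: denom_ratioP.
rewrite /= FracField.equivfE /FracField.mulf !numden_Ratio ?mulr1 ?oner_neq0 //.
by rewrite mulrC.
Qed.

(** When cancelling common factors does not lower the degree, there was nothing
    to cancel. *)
Lemma reduced_form (g : {fraction {poly K}}) (N D : {poly K}) n :
    g = N%:F / D%:F -> D != 0 -> (maxn (size N) (size D) <= n.+1)%N ->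
    rf_deg g = n ->
  [/\ coprimep N D, maxn (size N) (size D) = n.+1
    & exists2 e, e != 0 & N = e *: rf_num g /\ D = e *: rf_den g].
Proof.
move=> gE nzD sz; rewrite /rf_deg.
set n0 := rf_num g; set d0 := rf_den g => deg.
have nzd : \d_(repr g) != 0 by exact: denom_ratioP.
set h := gcdp \n_(repr g) \d_(repr g).
have nE : \n_(repr g) = n0 * h by rewrite divpK // dvdp_gcdl.
have dE : \d_(repr g) = d0 * h by rewrite divpK // dvdp_gcdr.
have nzh : h != 0 by rewrite gcdp_eq0 negb_and nzd orbT.
have nzd0 : d0 != 0 by apply: contraNneq nzd => d00; rewrite dE d00 mul0r.
have co : coprimep n0 d0 by apply: coprimep_div_gcd; rewrite nzd orbT.
have cross : n0 * D = N * d0.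
  apply: (mulIf nzh); rewrite mulrAC -nE -mulrA -dE.
  apply/eqP; rewrite -tofrac_eq !tofracM.
  by rewrite -eqr_div ?tofrac_eq0 // -frac_repr gE.
have /dvdpP[e De] : d0 %| D.
  by rewrite -(@Gauss_dvdpr _ _ n0) 1?coprimep_sym // cross dvdp_mulIr.
have Ne : N = e * n0.
  by apply: (mulIf nzd0); rewrite -cross De mulrC -mulrA [d0 * _]mulrC mulrA.
have nze : e != 0 by apply: contraNneq nzD => e0; rewrite De e0 mul0r.
have sz0 : maxn (size n0) (size d0) = n.+1.
  by rewrite -deg prednK // leq_max !size_poly_gt0 nzd0 orbT.
have [sze szm] : size e = 1%N /\ maxn (size N) (size D) = n.+1.
  have e_gt0 : (0 < size e)%N by rewrite size_poly_gt0.
  have d_gt0 : (0 < size d0)%N by rewrite size_poly_gt0.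
  have sD : size D = (size e + size d0).-1 by rewrite De size_mul.
  have sN : size N = if n0 == 0 then 0%N else (size e + size n0).-1.
    have [n00|nn0] := eqVneq n0 0; first by rewrite Ne n00 mulr0 size_poly0.
    by rewrite Ne size_mul.
  have n_eq0 : (n0 == 0) = (size n0 == 0%N) by rewrite size_poly_eq0.
  move: sz sz0 e_gt0 d_gt0; rewrite sD sN n_eq0; clear.
  by move: (size e) (size n0) (size d0) => u v w; case: eqP; lia.
have /size_poly1P[e0 nze0 eE] : size e == 1%N by rewrite sze.
split=> //; last by exists e0; rewrite // De Ne eE !mul_polyC.
by rewrite De Ne eE !mul_polyC coprimepZl // coprimepZr.
Qed.

End ReducedForm.

Section Separable.
Variable K : fieldType.

(** The constants of the derivation d/dX of the rational function field, given
    without extending the derivation to fractions. *)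
Definition deriv_const (u : {fraction {poly K}}) : Prop :=
  exists N D : {poly K}, [/\ D != 0, N^`() = 0, D^`() = 0 & u = N%:F / D%:F].

Lemma deriv_const_poly (p : {poly K}) : p^`() = 0 -> deriv_const p%:F.
Proof. by move=> p0; exists p, 1; rewrite oner_neq0 derivC tofrac1 divr1. Qed.

Lemma deriv_constD u v : deriv_const u -> deriv_const v -> deriv_const (u + v).
Proof.
move=> [N [D [nD N0 D0 ->]]] [N' [D' [nD' N'0 D'0 ->]]].
exists (N * D' + N' * D), (D * D'); split; rewrite ?mulf_neq0 //.
- by rewrite derivD !derivM N0 D0 N'0 D'0 !(mul0r, mulr0, addr0).
- by rewrite derivM D0 D'0 mul0r mulr0 addr0.
by rewrite tofracD !tofracM addf_div // tofrac_eq0.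
Qed.

Lemma deriv_constM u v : deriv_const u -> deriv_const v -> deriv_const (u * v).
Proof.
move=> [N [D [nD N0 D0 ->]]] [N' [D' [nD' N'0 D'0 ->]]].
exists (N * N'), (D * D'); split; rewrite ?mulf_neq0 //.
- by rewrite derivM N0 N'0 mul0r mulr0 addr0.
- by rewrite derivM D0 D'0 mul0r mulr0 addr0.
by rewrite !tofracM mulf_div.
Qed.

Lemma deriv_constV u : deriv_const u -> deriv_const u^-1.
Proof.
move=> [N [D [nD N0 D0 ->]]]; have [-> | nN] := eqVneq N 0.
  rewrite tofrac0 mul0r invr0 -tofrac0; apply: deriv_const_poly; exact: derivC.
by exists D, N; split; rewrite ?invf_div.
Qed.

Lemma deriv_const_subst g (p : {poly K}) : deriv_const g -> deriv_const (rf_subst g p).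
Proof.
move=> g0; rewrite /rf_subst; elim/poly_ind: p => [|p c IHp].
  by rewrite map_poly0 horner0 -tofrac0; apply: deriv_const_poly; exact: derivC.
have mapE : map_poly (fun c : K => (c%:P)%:F) (p * 'X + c%:P) =
    map_poly (fun c : K => (c%:P)%:F) p * 'X + ((c%:P)%:F)%:P.
  pose f : {rmorphism K -> {fraction {poly K}}} := @tofrac _ \o @polyC K.
  by rewrite -[map_poly _ _]/(map_poly f _) rmorphD rmorphM /= map_polyX map_polyC.
rewrite mapE hornerMXaddC; apply: deriv_constD; first exact: deriv_constM.
by apply: deriv_const_poly; exact: derivC.
Qed.

Lemma deriv_const_adjoin g u : deriv_const g -> in_adjoin g u -> deriv_const u.
Proof.
move=> g0 [N [D [_ ->]]].
by apply: deriv_constM; [|apply: deriv_constV]; apply: deriv_const_subst.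
Qed.

(** The common denominator [q] is itself constant for d/dX, so clearing it does
    not spoil the coefficients. *)
Lemma clear_denominators (P : {poly {fraction {poly K}}}) :
    (forall i, deriv_const P`_i) ->
  exists (q : {poly K}) (Q : {poly {poly K}}),
    [/\ q != 0, q^`() = 0, forall i, (Q`_i)^`() = 0 & q%:F *: P = map_poly (@tofrac _) Q].
Proof.
elim/poly_ind: P => [|P u IHP] cP.
  exists 1, 0; rewrite oner_neq0 scaler0 rmorph0; split=> //; first exact: derivC.
  by move=> i; rewrite coef0 deriv0.
have [i|q [Q [nq q0 Q0 qP]]] := IHP.
  by have := cP i.+1; rewrite coefD coefMX coefC addr0.
have [N [D [nD N0 D0 uE]]] : deriv_const u.
  by have := cP 0%N; rewrite coefD coefMX coefC add0r.
exists (q * D), (D%:P * Q * 'X + (q * N)%:P); split.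
- by rewrite mulf_neq0.
- by rewrite derivM q0 D0 mul0r mulr0 addr0.
- case=> [|i]; rewrite coefD coefMX coefC /= ?add0r ?addr0.
    by rewrite derivM q0 N0 mul0r mulr0 addr0.
  by rewrite coefCM derivM D0 Q0 mul0r mulr0 addr0.
rewrite rmorphD !rmorphM /= map_polyX !map_polyC /= -qP uE.
rewrite scalerDr -!mul_polyC (polyCM q%:F).
have -> : (N%:F)%:P = (D%:F)%:P * (N%:F / D%:F)%:P.
  by rewrite -polyCM mulrC divfK // tofrac_eq0.
move: (q%:F)%:P (D%:F)%:P (_ / _)%:P => A B C.
by rewrite (mulrA A B C) (mulrA (A * B)) (mulrA B A) (mulrC B A).
Qed.

Lemma deriv_horner (Q : {poly {poly K}}) (x : {poly K}) :
  (forall i, (Q`_i)^`() = 0) -> Q.[x]^`() = Q^`().[x] * x^`().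
Proof.
elim/poly_ind: Q => [|Q u IHQ] cQ; first by rewrite deriv0 !horner0 derivC mul0r.
have cQ' i : (Q`_i)^`() = 0 by have := cQ i.+1; rewrite coefD coefMX coefC addr0.
have u0 : u^`() = 0 by have := cQ 0%N; rewrite coefD coefMX coefC add0r.
rewrite hornerMXaddC derivD derivM u0 addr0 IHQ //.
rewrite derivD derivM derivC addr0 derivX mulr1 hornerD hornerM hornerX.
by ring.
Qed.

(** If the coefficients of P are constants for d/dX, applying d/dX to
    [P(X) = 0] gives [P'(X) = 0], so that P is not separable. *)
Lemma not_separable_deriv_const g : deriv_const g -> ~ rf_separable g.
Proof.
move=> g0 sepg; have [P [cP sepP rootP]] := sepg 'X%:F.
have [q [Q [nq _ Q0 qP]]] := clear_denominators (fun i => deriv_const_adjoin g0 (cP i)).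
have nqF : q%:F != 0 by rewrite tofrac_eq0.
have QX : Q.['X] = 0.
  apply/eqP; rewrite -tofrac_eq0 -horner_map -qP hornerZ (eqP rootP) mulr0.
  by rewrite eqxx.
have Q'X : Q^`().['X] = 0.
  by rewrite -[LHS]mulr1 -(derivX K) -deriv_horner // QX deriv0.
have : root P^`() 'X%:F.
  have : (q%:F *: P^`()).['X%:F] == 0.
    rewrite -derivZ qP deriv_map horner_map /= Q'X tofrac0.
    by rewrite eqxx.
  by rewrite hornerZ mulf_eq0 (negPf nqF).
rewrite unlock in sepP.
by have := coprimep_root sepP rootP; rewrite /root => /negPf ->.
Qed.
End Separable.

(** * The criterion *)

Section Criterion.
Variables (F : finFieldType) (m q : nat) (s : {rmorphism F -> F}).
Hypotheses (m0 : (0 < m)%N) (qE : q = (3 ^ m)%N) (cF : #|F| = (q ^ 2)%N).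
Hypothesis sE : forall x, s x = x ^+ q.
Hypothesis F3 : 3%:R = 0 :> F.

Variables a b c d : F.
Let D := cubic a b c d.
Let N := cubic (s d) (s c) (s b) (s a).
Hypothesis coND : coprimep (cubic (s d)%:P (s c)%:P (s b)%:P (s a)%:P 'X)
                           (cubic a%:P b%:P c%:P d%:P 'X).
Hypothesis lead : (s d != 0) || (a != 0).

Let sK := frob_involutive cF sE.

(** The power of the discriminant takes the value 1 after multiplication by
    [X^2] at all powers of [gamma], the roots of [X^(q+1) - 1]; the method of
    Stepanov excludes this for a separable discriminant. *)
Lemma injective_norms (gamma : F) : q.+1.-primitive_root gamma ->
  proj_injective s a b c d -> b * s b = c * s c.
Proof.
move=> pr_g injg; apply/eqP; apply: contraT => indep.
pose k := q./2.
have odd_q : odd q by rewrite qE oddX orbT.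
have qk : q = k.*2.+1 by rewrite -[LHS]odd_double_half odd_q.
have q0 : q%:R = 0 :> F by rewrite qE natrX F3 expr0n eqn0Ngt m0.
have k1 : k%:R = 1 :> F.
  have : k.*2.+1%:R = 0 :> F by rewrite -qk.
  rewrite -addn1 natrD -addnn natrD => H.
  by apply: subr0_eq; rewrite -oppr0 -H; ring3 F3.
have co := pencil_disc_coprime F3 coND lead indep.
set dl := pencil_disc s a b c d in co *.
have s5 : (size dl <= 5)%N by apply: size_pencil_disc.
have s4 : (4 <= size dl)%N by apply: size_pencil_disc_ge.
have dvd : 'X^(q.+1) - 1 %| 'X^2 * dl ^+ k - 1.
  rewrite -(factor_Xn_sub_1 pr_g).
  rewrite -(big_map (fun i => gamma ^+ i) xpredT (fun z => 'X - z%:P)).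
  apply: uniq_roots_dvdp.
    apply/allP => _ /mapP[i _ ->].
    have ui : unitary s (gamma ^+ i).
      by apply/(unitaryE sE); rewrite -exprM mulnC exprM (prim_expr_order pr_g) expr1n.
    have := disc_power cF sE F3 coND qk indep injg ui; rewrite /root -/dl.
    by move: (dl) => P PE; rewrite !(hornerE, horner_exp) PE subrr.
  rewrite uniq_rootsE map_inj_in_uniq ?iota_uniq // => i j.
  rewrite !mem_index_iota /= => ltiq ltjq /eqP.
  by rewrite (eq_prim_root_expr pr_g) !modn_small // => /eqP.
have [q3 | q_gt3] := leqP q 3.
  have q_3 : q = 3%N.
    by apply/eqP; rewrite eqn_leq q3 qE -{1}(expn1 3) leq_exp2l.
  have k_1 : k = 1%N by rewrite /k q_3.
  move: dvd; rewrite q_3 k_1 expr1; apply: contraTT => _; apply/negP.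
  apply: separable_no_power_root3 => //.
  by rewrite pencil_disc_coef0 // sE q_3.
case: (separable_no_power_root F3 qk k1 s5 s4 co _ dvd).
have m2 : (1 < m)%N.
  by rewrite ltnNge; apply: contraL q_gt3 => m1; rewrite -leqNgt qE (leq_exp2l m 1).
by rewrite qE; have := leq_exp2l 2 m (isT : 1 < 3)%N; rewrite m2 => /(leq_trans _) ->.
Qed.

(** When b * s b = c * s c, the coefficients p1 and p2 of N - beta D vanish, and
    a cubic without middle terms is a cube, as cubing is bijective.  The root is
    unitary because its cube is. *)
Lemma totally_ramified_fibre : b != 0 -> b * s b = c * s c ->
  let beta := s c / b in
  let p3 := s d - beta * a in
  [/\ unitary s beta, p3 != 0
    & exists x0, [/\ unitary s x0, x0 ^+ 3 = - (s a - beta * d) / p3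
                   & forall x, N x = beta * D x + p3 * (x - x0) ^+ 3]].
Proof.
move=> nb norms beta p3; pose p0 := s a - beta * d.
have nc : c != 0.
  apply: contraNneq nb => c0; move/eqP: norms.
  by rewrite c0 mul0r mulf_eq0 fmorph_eq0 orbb.
have ub : unitary s beta.
  rewrite /unitary /beta rmorphM fmorphV /= sK.
  have nsb : s b != 0 by rewrite fmorph_eq0.
  by rewrite mulrACA -invfM norms [s c * c]mulrC divff // mulf_neq0 ?fmorph_eq0.
have nbeta := unitary_neq0 ub.
have sc : s c = beta * b by rewrite /beta divfK.
have sb : s b = beta * c.
  by apply: (can_inj sK); rewrite sK rmorphM /= sc (unitary_conj ub) mulKf.
have sp3 : s p3 = - p0 / beta.
  by rewrite /p3 /p0 rmorphB rmorphM /= sK (unitary_conj ub); field.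
have np3 : p3 != 0.
  (* Otherwise N would be a multiple of D. *)
  apply/eqP => p30; have p00 : p0 = 0.
    move: sp3; rewrite p30 rmorph0 => /eqP.
    by rewrite eq_sym mulf_eq0 invr_eq0 (negPf nbeta) orbF oppr_eq0 => /eqP.
  have NE : cubic (s d)%:P (s c)%:P (s b)%:P (s a)%:P 'X = beta *: cubic a%:P b%:P c%:P d%:P 'X.
    move/subr0_eq: p30 => ->; move/subr0_eq: p00 => ->; rewrite sc sb -mul_polyC.
    by rewrite /cubic !polyCM; ring.
  move: coND; rewrite NE coprimepZl // coprimepp => /eqP sz.
  have : (cubic a%:P b%:P c%:P d%:P 'X)`_2 = 0 by rewrite nth_default // sz.
  rewrite /cubic !coefE /= !(mulr0, addr0, add0r, mulr1) => /eqP.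
  by rewrite (negPf nb).
split=> //; have [x0 x0E] := cube_root m0 qE cF (- p0 / p3).
have sp0 : s p0 = - p3 / beta.
  by rewrite /p3 /p0 rmorphB rmorphM /= sK (unitary_conj ub); field.
have np0 : p0 != 0.
  apply: contraNneq np3 => p00.
  by rewrite -(inj_eq (can_inj sK)) rmorph0 sp3 p00 oppr0 mul0r.
exists x0; split=> //; last first.
  move=> x; have -> : p3 * (x - x0) ^+ 3 = p3 * x ^+ 3 + p0.
    have -> : p0 = - p3 * x0 ^+ 3 by rewrite -x0E; field.
    by ring3 F3.
  by rewrite /N /D /cubic sc sb /p3 /p0; ring.
have : (x0 * s x0 - 1) ^+ 3 = 0.
  have -> : (x0 * s x0 - 1) ^+ 3 = x0 ^+ 3 * s (x0 ^+ 3) - 1 by rewrite rmorphXn; ring3 F3.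
  rewrite -x0E rmorphM fmorphV rmorphN /= sp0 sp3.
  by field; rewrite oppr_eq0 nbeta np0 np3.
by move/eqP; rewrite expf_eq0 /= subr_eq0 => /eqP.
Qed.

Lemma quotient_nonsquareE n e rho : e != 0 -> n / e = rho -> s rho = rho -> rho != 0 ->
  quotient_nonsquare_Fq q n e <-> ~ exists2 z, s z = z & rho = z ^+ 2.
Proof.
move=> ne nE fr nr; rewrite /quotient_nonsquare_Fq /nonsquare_Fq nE.
split=> [[_ [_ _ nsq]] [z fz rz]|nsq].
  by case: nsq; exists z; rewrite // (mem_Fq sE) fz.
split=> //; split; rewrite ?(mem_Fq sE) ?fr // => -[z fz rz].
by case: nsq; exists z => //; apply/eqP; rewrite -(mem_Fq sE).
Qed.

(** [N alpha], [D alpha], [A3] and [B3] are the coefficients of degrees 3 and 1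
    of numerator and denominator after the substitution [line_point] with
    [x0 = alpha].  The numerator coefficients are [beta] times the denominator
    ones, so the parameter [r'] of the target cancels and [- B3 / D alpha]
    remains. *)
Lemma quotient_ratio alpha beta r r' :
    unitary s alpha -> unitary s beta -> unitary s r -> unitary s r' -> s r' != r' ->
    b != 0 -> s c = beta * b -> s b = beta * c -> c = b * alpha ->
    N alpha = beta * D alpha -> D alpha != 0 ->
    let A3 := s c * (2%:R * alpha ^+ 2 + alpha ^+ 2 * s r ^+ 2)
              + s b * (2%:R * alpha + alpha * r ^+ 2) in
    let B3 := b * (2%:R * alpha ^+ 2 + alpha ^+ 2 * s r ^+ 2)
              + c * (2%:R * alpha + alpha * r ^+ 2) in
  r' * N alpha - beta * s r' * D alpha != 0 /\
  (beta * s r' * B3 - r' * A3) / (r' * N alpha - beta * s r' * D alpha)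
   = quad_ratio s a b c d alpha r.
Proof.
move=> ua ub ur ur' nr' nb sc sb cE Na nD A3 B3.
have nbeta := unitary_neq0 ub; have nsr : r' - s r' != 0 by rewrite subr_eq0 eq_sym.
have den : r' * N alpha - beta * s r' * D alpha = beta * D alpha * (r' - s r').
  by rewrite Na; ring.
have B3E : B3 = b * alpha ^+ 2 * (r - s r) ^+ 2.
  rewrite /B3 cE.
  have -> : (r - s r) ^+ 2 = r ^+ 2 + s r ^+ 2 - 2%:R * (r * s r) by ring.
  by rewrite ur; ring3 F3.
have A3E : A3 = beta * B3 by rewrite /A3 /B3 sc sb; ring.
rewrite den; split; first by rewrite !mulf_neq0.
rewrite A3E B3E /quad_ratio -/(D alpha).
by field; rewrite nD nbeta nsr.
Qed.

Lemma unitary_pred_power u : unitary s u -> u ^+ (q - 1) = s u ^+ 2.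
Proof.
move=> uu; apply: (mulfI (unitary_neq0 uu)).
have q0 : (0 < q)%N by rewrite qE expn_gt0.
by rewrite -exprS subn1 prednK // -sE expr2 mulrA uu mul1r.
Qed.

Section FixedCube.
Variables alpha beta : F.
Hypotheses (ua : unitary s alpha) (ub : unitary s beta) (nb : b != 0).
Hypotheses (sc : s c = beta * b) (cE : c = b * alpha).
Hypothesis np3 : s d - beta * a != 0.
Hypothesis numE : forall x, N x = beta * D x + (s d - beta * a) * (x - alpha) ^+ 3.

Lemma injective_quotient r r' :
    unitary s r -> s r != r -> unitary s r' -> s r' != r' ->
    let A3 := s c * (2%:R * alpha ^+ 2 + alpha ^+ 2 * s r ^+ 2)
              + s b * (2%:R * alpha + alpha * r ^+ 2) in
    let B3 := b * (2%:R * alpha ^+ 2 + alpha ^+ 2 * s r ^+ 2)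
              + c * (2%:R * alpha + alpha * r ^+ 2) in
  proj_injective s a b c d <->
  quotient_nonsquare_Fq q (beta * s r' * B3 - r' * A3)
    (r' * N alpha - beta * s r' * D alpha).
Proof.
move=> ur nr ur' nr' A3 B3.
have nD := den_neq0 coND.
have e0 : c - b * alpha = 0 by rewrite {1}cE subrr.
have sb : s b = beta * c by apply: conj_b ub sc.
have Na : N alpha = beta * D alpha by rewrite numE subrr expr0n mulr0 addr0.
have [ne nE] := quotient_ratio ua ub ur ur' nr' nb sc sb cE Na (nD _ ua).
have qf := quad_ratio_fixed sK ua ub sc numE nD r e0.
have q0 := quad_ratio_neq0 ua nb nD nr.
have := quotient_nonsquareE ne nE qf q0.
have := injective_nonsquare sK F3 ua nb np3 numE nD nr e0.
by move=> -> ->.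
Qed.

(** Instances of [injective_quotient]: [r] is [alpha] if [s] moves it, else
    [beta] if [s] moves that, else [gamma]; [r'] is [beta] if [s] moves it, else
    the same as [r]. *)
Lemma injective_cases gamma : unitary s gamma -> s gamma != gamma ->
  let A1 := N alpha in let B1 := D alpha in
  proj_injective s a b c d <->
  [\/ [/\ alpha \notin Fq F q, beta \notin Fq F q &
        let A3 := s c * (2%:R * alpha ^+ 2 + 1)
                  + s b * (2%:R * alpha + alpha ^+ 3) in
        let B3 := b * (2%:R * alpha ^+ 2 + 1)
                  + c * (2%:R * alpha + alpha ^+ 3) in
        quotient_nonsquare_Fq q (B3 - beta * A3) (beta * A1 - B1)],
      [/\ alpha \notin Fq F q, beta \in Fq F q &
        let A3 := s c * (2%:R * alpha ^+ 2 + 1)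
                  + s b * (2%:R * alpha + alpha ^+ 3) in
        let B3 := b * (2%:R * alpha ^+ 2 + 1)
                  + c * (2%:R * alpha + alpha ^+ 3) in
        quotient_nonsquare_Fq q
          (beta * s alpha * B3 - alpha * A3)
          (alpha * A1 - beta * s alpha * B1)],
      [/\ alpha \in Fq F q, beta \notin Fq F q &
        let A3 := s c * (2%:R * alpha ^+ 2 + alpha ^+ 2 * beta ^+ (q - 1))
                  + s b * (2%:R * alpha + alpha * beta ^+ 2) in
        let B3 := b * (2%:R * alpha ^+ 2 + alpha ^+ 2 * beta ^+ (q - 1))
                  + c * (2%:R * alpha + alpha * beta ^+ 2) in
        quotient_nonsquare_Fq q (B3 - beta * A3) (beta * A1 - B1)] |
      [/\ alpha \in Fq F q, beta \in Fq F q &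
        let A3 := s c * (2%:R * alpha ^+ 2 + alpha ^+ 2 * gamma ^+ (q - 1))
                  + s b * (2%:R * alpha + alpha * gamma ^+ 2) in
        let B3 := b * (2%:R * alpha ^+ 2 + alpha ^+ 2 * gamma ^+ (q - 1))
                  + c * (2%:R * alpha + alpha * gamma ^+ 2) in
        quotient_nonsquare_Fq q
          (beta * s gamma * B3 - gamma * A3)
          (gamma * A1 - beta * s gamma * B1)]].
Proof.
move=> ug ng A1 B1.
have alpha2 : alpha ^+ 2 * s alpha ^+ 2 = 1 by rewrite -exprMn ua expr1n.
have alpha3 : alpha * alpha ^+ 2 = alpha ^+ 3 by rewrite -exprS.
have IQ := injective_quotient; cbv zeta in IQ |- *.
rewrite !(mem_Fq sE) /A1 /B1.
have [fa|na] := eqVneq (s alpha) alpha; have [fb|nbt] := eqVneq (s beta) beta.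
- rewrite (unitary_pred_power ug).
  split=> [/(IQ _ _ ug ng ug ng) H | [] [] // _ _ H]; first exact: Or44.
  exact/(IQ _ _ ug ng ug ng).
- have := IQ _ _ ub nbt ub nbt; rewrite ub !mul1r (unitary_pred_power ub) => {}IQ.
  by split=> [/IQ H | [] [] // _ _ /IQ //]; apply: Or43.
- have := IQ _ _ ua na ua na; rewrite alpha2 alpha3 => {}IQ.
  by split=> [/IQ H | [] [] // _ _ /IQ //]; apply: Or42.
have := IQ _ _ ua na ub nbt; rewrite alpha2 alpha3 ub !mul1r => {}IQ.
by split=> [/IQ H | [] [] // _ _ /IQ //]; apply: Or41.
Qed.
End FixedCube.

End Criterion.

Section Permutation.
Variables (F : finFieldType) (q : nat) (s : {rmorphism F -> F}).
Hypothesis cF : #|F| = (q ^ 2)%N.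
Hypothesis sE : forall x, s x = x ^+ q.
Variables a b c d : F.

Lemma permutes_injective (g : {fraction {poly F}}) e :
    coprimep (cubic (s d)%:P (s c)%:P (s b)%:P (s a)%:P 'X)
             (cubic a%:P b%:P c%:P d%:P 'X) ->
    e != 0 -> cubic (s d)%:P (s c)%:P (s b)%:P (s a)%:P 'X = e *: rf_num g ->
    cubic a%:P b%:P c%:P d%:P 'X = e *: rf_den g ->
  permutes g (mu F q.+1) <-> proj_injective s a b c d.
Proof.
move=> coND ne numE denE.
have nE x : cubic (s d) (s c) (s b) (s a) x = e * (rf_num g).[x].
  by rewrite -horner_cubic numE hornerZ.
have dE x : cubic a b c d x = e * (rf_den g).[x].
  by rewrite -horner_cubic denE hornerZ.
have nD x : unitary s x -> (rf_den g).[x] != 0.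
  by move=> ux; have := den_neq0 coND ux; rewrite dE mulf_eq0 negb_or => /andP[].
have evalE x : rf_eval g x = cubic (s d) (s c) (s b) (s a) x / cubic a b c d x.
  by rewrite nE dE -mulf_div divff // mul1r.
split=> [[_ inj_g _] x y ux uy eqg | injg].
  apply: (inj_g x y); [exact/(mem_mu sE) | exact/(mem_mu sE) | ].
  by rewrite !evalE; apply/eqP; rewrite eqr_div ?(den_neq0 coND) // eqg.
split=> [x /(mem_mu sE) | x y /(mem_mu sE) ux /(mem_mu sE) uy | ].
- exact: nD.
- rewrite !evalE => /eqP; rewrite eqr_div ?(den_neq0 coND) // => /eqP.
  exact: injg.
apply/setP => t; apply/imsetP/idP => [[x /(mem_mu sE) ux ->] | /(mem_mu sE) ut].
  by apply/(mem_mu sE); rewrite evalE; apply: (quotient_unitary cF sE coND).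
have [x ux Nx] := injective_onto cF sE coND injg ut.
exists x; first exact/(mem_mu sE).
by rewrite evalE Nx mulfK // (den_neq0 coND).
Qed.
End Permutation.

Theorem theorem4 (m q : nat) (F : finFieldType)
    (hm : (0 < m)%N) (hq : q = (3 ^ m)%N) (hF : #|F| = (q ^ 2)%N)
    (a b c d : F) (habcd : ~ [/\ a = 0, b = 0, c = 0 & d = 0])
    (g : {fraction {poly F}})
    (hg : g =
      ((d ^+ q)%:P * 'X^3 + (c ^+ q)%:P * 'X^2 + (b ^+ q)%:P * 'X
        + (a ^+ q)%:P)%:F
      / (a%:P * 'X^3 + b%:P * 'X^2 + c%:P * 'X + d%:P)%:F)
    (hdeg : rf_deg g = 3%N) (hsep : rf_separable g)
    (alpha beta : F)
    (halpha : alpha =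
      (c * d ^+ q - a * b ^+ q) / (b * d ^+ q - a * c ^+ q))
    (hbeta : beta = c ^+ q / b)
    (gamma : F) (hgamma : q.+1.-primitive_root gamma) :
  let A1 := d ^+ q * alpha ^+ 3 + c ^+ q * alpha ^+ 2 + b ^+ q * alpha
            + a ^+ q in
  let B1 := a * alpha ^+ 3 + b * alpha ^+ 2 + c * alpha + d in
  permutes g (mu F q.+1) <->
  [/\ b * d ^+ q != a * c ^+ q,
      alpha ^+ 3 = (c ^+ q * d - a ^+ q * b) / (b * d ^+ q - a * c ^+ q),
      alpha \in mu F q.+1,
      b != 0 /\ beta \in mu F q.+1
    & [\/
      [/\ alpha \notin Fq F q, beta \notin Fq F q &
        let A3 := c ^+ q * (2%:R * alpha ^+ 2 + 1)
                  + b ^+ q * (2%:R * alpha + alpha ^+ 3) in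
        let B3 := b * (2%:R * alpha ^+ 2 + 1)
                  + c * (2%:R * alpha + alpha ^+ 3) in
        quotient_nonsquare_Fq q (B3 - beta * A3) (beta * A1 - B1)],
      [/\ alpha \notin Fq F q, beta \in Fq F q &
        let A3 := c ^+ q * (2%:R * alpha ^+ 2 + 1)
                  + b ^+ q * (2%:R * alpha + alpha ^+ 3) in
        let B3 := b * (2%:R * alpha ^+ 2 + 1)
                  + c * (2%:R * alpha + alpha ^+ 3) in
        quotient_nonsquare_Fq q
          (beta * alpha ^+ q * B3 - alpha * A3)
          (alpha * A1 - beta * alpha ^+ q * B1)],
      [/\ alpha \in Fq F q, beta \notin Fq F q &
        let A3 := c ^+ q * (2%:R * alpha ^+ 2 + alpha ^+ 2 * beta ^+ (q - 1))
                  + b ^+ q * (2%:R * alpha + alpha * beta ^+ 2) in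
        let B3 := b * (2%:R * alpha ^+ 2 + alpha ^+ 2 * beta ^+ (q - 1))
                  + c * (2%:R * alpha + alpha * beta ^+ 2) in
        quotient_nonsquare_Fq q (B3 - beta * A3) (beta * A1 - B1)] |
      [/\ alpha \in Fq F q, beta \in Fq F q &
        let A3 := c ^+ q * (2%:R * alpha ^+ 2 + alpha ^+ 2 * gamma ^+ (q - 1))
                  + b ^+ q * (2%:R * alpha + alpha * gamma ^+ 2) in
        let B3 := b * (2%:R * alpha ^+ 2 + alpha ^+ 2 * gamma ^+ (q - 1))
                  + c * (2%:R * alpha + alpha * gamma ^+ 2) in
        quotient_nonsquare_Fq q
          (beta * gamma ^+ q * B3 - gamma * A3)
          (gamma * A1 - beta * gamma ^+ q * B1)]]].
Proof.
move=> A1 B1.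
have F3 : 3%:R = 0 :> F.
  by apply: (@card_char3 _ (m * 2)); rewrite ?muln_gt0 ?hm // hF hq expnM.
have [s sE] := frobenius_rmorphism hq F3.
move: @A1 @B1 hg halpha hbeta; rewrite -!sE => A1 B1 hg halpha hbeta.
pose N := cubic (s d)%:P (s c)%:P (s b)%:P (s a)%:P 'X.
pose D := cubic a%:P b%:P c%:P d%:P 'X.
have {}hg : g = N%:F / D%:F by [].
have nzD : D != 0 by apply/eqP => /cubic_eq0.
have szND : (maxn (size N) (size D) <= 4)%N.
  by rewrite geq_max !size_cubic //; case: (_ == _).
have [coND sz [e ne [numE denE]]] := reduced_form hg nzD szND hdeg.
have lead : (s d != 0) || (a != 0).
  rewrite -negb_and; apply/negP => /andP[sd0 a0].
  have : (maxn (size N) (size D) <= 3)%N by rewrite geq_max !size_cubic // ?sd0 ?a0.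
  by rewrite sz.
have nz_bc : ~ (b = 0 /\ c = 0).
  move=> [b0 c0]; case: (not_separable_deriv_const _ hsep).
  by exists N, D; split=> //; rewrite /N /D b0 c0 ?rmorph0 deriv_cubic0.
have sK := frob_involutive hF sE.
have injE := permutes_injective hF sE coND ne numE denE.
have ug : unitary s gamma by apply/(unitaryE sE); exact: prim_expr_order hgamma.
have ng : s gamma != gamma.
  apply/eqP => fg; have : gamma ^+ 2 = gamma ^+ 0 by rewrite expr0 -ug fg.
  move/eqP; rewrite (eq_prim_root_expr hgamma) mod0n modn_small // hq ltnS.
  by rewrite (leq_trans _ (leq_pexp2l (isT : (0 < 3)%N) hm)).
have cases := injective_cases hq hF sE F3 coND.
split=> [/injE injg | [indep alpha3 /(mem_mu sE) ua [nb /(mem_mu sE) ub] disj]].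
  have norms := injective_norms hm hq hF sE F3 coND lead hgamma injg.
  have nb : b != 0.
    apply/eqP => b0; apply: nz_bc; split=> //; apply/eqP.
    by move: norms; rewrite b0 mul0r => /esym/eqP; rewrite mulf_eq0 fmorph_eq0 orbb.
  have := totally_ramified_fibre hm hq hF sE F3 coND nb norms; rewrite -hbeta /=.
  move=> [ub np3 [x0 [ux0 x03 Neq]]].
  have sc : s c = beta * b by rewrite hbeta divfK.
  have sb : s b = beta * c by apply: conj_b ub sc.
  have cE : c = b * x0.
    apply/subr0_eq.
    exact: (injective_no_quadratic_term sK F3 ux0 ub sc np3 Neq (den_neq0 coND) ng injg).
  have dE : b * s d - a * s c = b * (s d - beta * a) by rewrite sc; ring.
  have nd : b * s d - a * s c != 0 by rewrite dE mulf_neq0.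
  have aE : alpha = x0.
    by rewrite halpha dE sb {1 2}cE; field; rewrite nb np3.
  subst x0; split.
  - by rewrite -subr_eq0.
  - by rewrite x03 dE sc; field; rewrite np3 nb.
  - exact/(mem_mu sE).
  - by split; [|apply/(mem_mu sE)].
  exact/(cases _ _ ux0 ub nb sc cE np3 Neq _ ug ng).
have sc : s c = beta * b by rewrite hbeta divfK.
have sb : s b = beta * c by apply: conj_b ub sc.
have norms : b * s b = c * s c by rewrite sb sc; ring.
have [_ np3 [x0 [ux0 x03 Neq]]] := totally_ramified_fibre hm hq hF sE F3 coND nb norms.
rewrite -hbeta in np3 x03 Neq.
have dE : b * s d - a * s c = b * (s d - beta * a) by rewrite sc; ring.
have cE : c = b * alpha.
  by rewrite halpha dE sb; field; rewrite nb np3.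
have aE : alpha = x0.
  have : (alpha - x0) ^+ 3 = 0.
    have -> : (alpha - x0) ^+ 3 = alpha ^+ 3 - x0 ^+ 3 by ring3 F3.
    by rewrite alpha3 x03 dE sc; field; rewrite np3 nb.
  by move/eqP; rewrite expf_eq0 /= subr_eq0 => /eqP.
subst x0; apply/injE/(cases _ _ ua ub nb sc cE np3 Neq _ ug ng).
exact: disj.
Qed.
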